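(* Let $m=p^{u-1}$ be a power of $p$, let $\ell\ge 2$ be a positive integer, and suppose that $a_1,\dots,a_\ell,b_1,\dots,b_{\ell-1}$ are distinct elements of $\mathbb{F}_q$. Let $F=\mathbb{F}_q(x,y)$ be a function field defined by the equation $$\mathrm{Tr}_{p^u/p}(y)=\frac{\prod_{i=1}^{\ell}(x-a_i)}{\prod_{i=1}^{\ell-1}(x-b_i)},$$ where $\mathrm{Tr}_{p^u/p}(y)$ denotes the trace map of $\mathbb{F}_{p^u}$ over $\mathbb{F}_p$, with degree $p^{u-1}$. Then $F/\mathbb{F}_q$ is an $(m,n)$-friendly algebraic function field.
   Context: Here $q$ is a power of the prime $p$, $n$ is a positive integer, and $\mathrm{Tr}_{p^u/p}(y)$ is the polynomial $y^{p^{u-1}}+y^{p^{u-2}}+\cdots+y^p+y$; $v_P$ is the discrete valuation at a place $P$ of a function field, $(z)_\infty$ is the pole divisor of $z$, and $g(F)$ is the genus of $F$. Definition. An $(m,n)$-friendly algebraic function field is a function field $F/\mathbb{F}_q$ with a place $Q$ of $F/\mathbb{F}_q$ such that: (1) the genus satisfies $(m-1)\mid g(F)$; (2) there exists $z_1\in F$ with $v_Q(z_1)=1$ and $\deg((z_1)_\infty)=\frac{g(F)}{m-1}+1$; (3) there exists $z_2$ such that $(z_2)_\infty=mQ$. *)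

(* Defs.v *)
From HB Require Import structures.
From mathcomp Require Import all_boot all_order all_algebra.
From mathcomp Require Import boolp classical_sets functions cardinality fsbigop.

Set Implicit Arguments.
Unset Strict Implicit.
Unset Printing Implicit Defensive.

Import Order.TTheory GRing.Theory Num.Theory.
Local Open Scope classical_set_scope.
Local Open Scope ring_scope.

(* An extension F/K is given by an embedding iota : K -> F: MathComp's
   fieldExtType covers only extensions of finite degree. *)

(* The smallest subfield of F containing iota(K) and X, i.e. K(X). *)
Definition adjoin (K F : fieldType) (iota : {rmorphism K -> F})
    (X : set F) : set F :=
  [set z | forall E : {pred F}, GRing.divring_closed E ->
     (forall c : K, iota c \in E) -> (forall w, X w -> w \in E) -> z \in E].

(* Algebraic function field of one variable with full constant field K:
   F is a finite extension of K(t) for some t transcendental over K, and K is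
   algebraically closed in F. *)
Definition function_field (K F : fieldType) (iota : {rmorphism K -> F}) : Prop :=
  (exists2 t : F, ~ algebraicOver iota t &
     exists (d : nat) (e : 'I_d -> F), forall z : F,
       exists2 c : 'I_d -> F, (forall i, adjoin iota [set t] (c i))
                            & z = \sum_(i < d) c i * e i) /\
  (forall z : F, algebraicOver iota z -> exists c : K, z = iota c).

(* A place P is represented by its normalized discrete valuation v_P, trivial
   on K.  The value v_P(0), which should be +oo, is the dummy value 0, so that
   a place is determined by its valuation on nonzero elements; every use of
   [val_at] below treats z = 0 separately or excludes it. *)
Record place (K F : fieldType) (iota : {rmorphism K -> F}) := Place {
  val_at :> F -> int;
  val_at0 : val_at 0 = 0;
  val_atM : forall x y : F, x != 0 -> y != 0 ->
    val_at (x * y) = val_at x + val_at y;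
  val_atD : forall x y : F, x != 0 -> y != 0 -> x + y != 0 ->
    Num.min (val_at x) (val_at y) <= val_at (x + y);
  val_atK : forall c : K, c != 0 -> val_at (iota c) = 0;
  val_at1 : exists2 t : F, t != 0 & val_at t = 1 }.

HB.instance Definition _ (K F : fieldType) (iota : {rmorphism K -> F}) :=
  gen_eqMixin (place iota).
HB.instance Definition _ (K F : fieldType) (iota : {rmorphism K -> F}) :=
  gen_choiceMixin (place iota).

Section FunctionField.
Variables (K F : fieldType) (iota : {rmorphism K -> F}).
Implicit Types (P Q : place iota) (A : place iota -> int) (V W : set F).

(* For K-subspaces W of V of F: the classes of the e_i form a K-basis of V/W. *)
Definition quotient_basis V W (d : nat) (e : 'I_d -> F) : Prop :=
  (forall i, V (e i)) /\
  (forall z, V z ->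
     exists! c : {ffun 'I_d -> K}, W (z - \sum_(i < d) iota (c i) * e i)).

(* dim_K (V/W), with value 0 when the dimension is infinite. *)
Definition quotient_dim V W : nat :=
  xget 0%N [set d | exists e : 'I_d -> F, quotient_basis V W e].

Definition valuation_ring P : set F := [set z | z = 0 \/ 0 <= P z].
Definition maximal_ideal P : set F := [set z | z = 0 \/ 0 < P z].

Definition place_degree P : nat :=
  quotient_dim (valuation_ring P) (maximal_ideal P).

Definition is_divisor A : Prop := finite_set [set P | A P != 0].

(* The sum over all places is a finite sum when A is a divisor. *)
Definition divisor_degree A : int :=
  \sum_(P \in [set: place iota]) A P * (place_degree P)%:Z.

Definition place_divisor Q : place iota -> int :=
  fun P => if P == Q then 1 else 0.

(* For nonzero z; pole_divisor 0 is the dummy value 0. *)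
Definition pole_divisor (z : F) : place iota -> int :=
  fun P => Num.max 0 (- P z).

Definition riemann_roch_space A : set F :=
  [set z | z = 0 \/ forall P, - A P <= P z].

Definition ell A : nat := quotient_dim (riemann_roch_space A) [set 0].

(* g = max { deg A - l(A) + 1 | A a divisor of F/K } *)
Definition is_genus (g : nat) : Prop :=
  (forall A, is_divisor A ->
     divisor_degree A - (ell A)%:Z + 1 <= g%:Z) /\
  (exists2 A, is_divisor A & divisor_degree A - (ell A)%:Z + 1 = g%:Z).

(* The parameter n does not occur in the defining conditions.  For m = 1 the
   quotient g / (m - 1) is 0 / 0, read as 0. *)
Definition friendly (m n : nat) : Prop :=
  function_field iota /\
  exists2 g : nat, is_genus g &
  exists Q : place iota,
    [/\ (m - 1 %| g)%N,
        exists2 z1 : F, Q z1 = 1 &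
          divisor_degree (pole_divisor z1) = (g %/ (m - 1) + 1)%N%:Z
      & exists z2 : F, forall P, pole_divisor z2 P = m%:Z * place_divisor Q P].

End FunctionField.

Definition trace_poly (R : nzRingType) (p u : nat) : {poly R} :=
  \sum_(i < u) 'X^(p ^ i).

(* Main.v *)
Require Import Defs.
From HB Require Import structures.
From mathcomp Require Import all_boot all_order all_algebra finfield.
From mathcomp Require Import boolp classical_sets functions cardinality fsbigop.
From mathcomp Require Import zify ring.

Set Implicit Arguments.
Unset Strict Implicit.
Unset Printing Implicit Defensive.

Import Order.TTheory GRing.Theory Num.Theory.
Local Open Scope classical_set_scope.
Local Open Scope ring_scope.

(* At every pole of f = A / h (the place at infinity and the zeros of h) the
   equation Tr(y) = f forces v(y) < 0 and m v(y) = v(f), so these places are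
   totally ramified and v(y) = -1; elsewhere 1, y, ..., y^(m-1) is an integral
   basis because Tr has derivative 1.  Hence the functions whose only poles are
   at the place Q at infinity form K[x] + sum_(0 < j < m) h K[x] y^j, with pole
   orders m i and m (l - 1 + i) + j at Q: there are g = (l - 1)(m - 1) gaps.
   Counting them gives l((l-1) m Q) = l, and, for suitable zeta in K(x) with
   polar divisor D, l(D) >= deg D + 1 - g.  As deg A - l(A) increases with A,
   and every divisor is bounded by such a D, the genus is g.  One takes z2 = x
   and z1 = 1/y, whose poles are the l places x = a_i, y = 0 (z1 = 1/(x - a_1)
   when m = 1).  Places are obtained from Chevalley's theorem, and degrees are
   bounded by sum v_P(t) deg P <= [F : K(t)]. *)

(** * Dimensions of quotients of K-subspaces *)

(** The genus is a maximum over all divisors, so the obstacle is a bound valid for every one of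
    them. The argument runs on one-sided estimates: an upper bound of deg D by [F : K(zeta)] and a
    lower bound of l(D) by explicit functions already meet at g. For z1, the l distinct poles supply
    the inequality opposite to the general bound on degrees.

    That Tr has derivative 1 enters through the identity Tr(y)^p - Tr(y) = y^(p^u) - y: modulo
    K[x, 1/h], y is fixed by the p^u-th power map. Hence raising an integral element to the power
    p^(u n) acts on its coefficients in the basis y^j as a power of Frobenius, up to triangular
    terms, and denominators prime to h can be cancelled.

    Independence of 1, y, ..., y^(m-1) over K(x) is read off at infinity, where the valuations of
    the y^j are distinct modulo m while those of K(x) are multiples of m. *)

Lemma homogeneous_solution (K : fieldType) (I J : finType) (f : I -> J -> K) :
  (#|J| < #|I|)%N ->
  exists2 c : I -> K, exists i, c i != 0 & forall j, \sum_i c i * f i j = 0.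
Proof.
move=> ltJI.
pose A := \matrix_(i < #|I|, j < #|J|) f (enum_val i) (enum_val j).
have ker_neq0 : kermx A != 0.
  rewrite kermx_eq0; apply: contraTN ltJI => /eqP rkA.
  by rewrite -leqNgt -{1}rkA rank_leq_col.
have [i rowi] : exists i, row i (kermx A) != 0.
  apply/existsP; apply: contraNT ker_neq0; rewrite negb_exists => /forallP r0.
  by apply/eqP/row_matrixP => i; rewrite row0; apply/eqP; rewrite -[_ == _]negbK r0.
have [j cj] : exists j, row i (kermx A) 0 j != 0.
  apply/existsP; apply: contraNT rowi; rewrite negb_exists => /forallP r0.
  apply/eqP/matrixP => k j; rewrite [k]ord1 [RHS]mxE.
  by apply/eqP; rewrite -[_ == _]negbK r0.
exists (fun k => row i (kermx A) 0 (enum_rank k)).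
  by exists (enum_val j); rewrite enum_valK.
move=> k.
have /matrixP/(_ 0 (enum_rank k)) : row i (kermx A) *m A = 0.
  by rewrite -row_mul mulmx_ker row0.
rewrite [LHS]mxE [RHS]mxE => {2}<-.
rewrite [RHS](reindex _ (onW_bij _ (@enum_rank_bij I))) /=.
by apply: eq_bigr => s _; rewrite [A _ _]mxE !enum_rankK.
Qed.

Section QuotientDimension.
Variables (K F : fieldType) (iota : {rmorphism K -> F}).
Implicit Types (V W X : set F).

Definition subspace W : Prop :=
  [/\ W 0, forall z w, W z -> W w -> W (z + w)
     & forall c z, W z -> W (iota c * z)].

Definition free_mod W (I : finType) (e : I -> F) : Prop :=
  forall c : I -> K, W (\sum_i iota (c i) * e i) -> forall i, c i = 0.

Definition free_family V W (I : finType) (e : I -> F) : Prop :=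
  (forall i, V (e i)) /\ free_mod W e.

(** Since [quotient_dim] is 0 in infinite dimension, dimensions are handled through the one-sided
    [dim_ge] and [dim_le], which are meaningful before finiteness is known. *)
Definition dim_ge V W (n : nat) : Prop :=
  exists e : 'I_n -> F, free_family V W e.

Definition dim_le V W (d : nat) : Prop :=
  exists e : 'I_d -> F, forall z, V z ->
    exists c : 'I_d -> K, W (z - \sum_i iota (c i) * e i).

Lemma subspaceN W z : subspace W -> W z -> W (- z).
Proof. by case=> _ _ WZ /(WZ (-1)); rewrite rmorphN1 mulN1r. Qed.

Lemma subspaceB W z w : subspace W -> W z -> W w -> W (z - w).
Proof. by move=> sW Wz Ww; have [_ WD _] := sW; apply: WD => //; apply: subspaceN. Qed.

Lemma subspace_sum W (I : Type) (r : seq I) (Q : pred I) (f : I -> F) :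
  subspace W -> (forall i, Q i -> W (f i)) -> W (\sum_(i <- r | Q i) f i).
Proof. by case=> W0 WD _ Wf; elim/big_ind: _. Qed.

Lemma subspace0 : subspace [set 0 : F].
Proof.
by split=> [|z w -> ->|c z ->] //=; rewrite ?addr0 ?mulr0.
Qed.

Lemma dim_geP V W (I : finType) (e : I -> F) : free_family V W e -> dim_ge V W #|I|.
Proof.
case=> Ve fe; exists (fun i => e (enum_val i)); split=> [i|c Wc i]; first exact: Ve.
suff /fe/(_ (enum_val i)) : W (\sum_k iota (c (enum_rank k)) * e k) by rewrite enum_valK.
move: Wc; congr (W _); rewrite (reindex _ (onW_bij _ (@enum_rank_bij I))).
by apply: eq_bigr => s _; rewrite enum_rankK.
Qed.

Lemma dim_ge_le V W n d : subspace W -> dim_ge V W n -> dim_le V W d -> (n <= d)%N.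
Proof.
move=> sW [e [Ve fe]] [b spb]; rewrite leqNgt; apply/negP => lt_dn.
have /choice[c Wc] i : exists c : 'I_d -> K, W (e i - \sum_j iota (c j) * b j) by exact: spb.
have [|a [i /eqP ai0] ac] := @homogeneous_solution K 'I_n 'I_d c; first by rewrite !card_ord.
apply: ai0; apply: fe.
have : W (\sum_i iota (a i) * (e i - \sum_j iota (c i j) * b j)).
  by apply: subspace_sum => // k _; case: sW => _ _; apply.
congr (W _); under eq_bigr do rewrite mulrBr.
rewrite sumrB -[RHS]subr0; congr (_ - _).
under eq_bigr do rewrite mulr_sumr.
rewrite exchange_big big1 // => j _.
under eq_bigr do rewrite mulrA -rmorphM.
by rewrite -mulr_suml -rmorph_sum ac rmorph0 mul0r.
Qed.

Lemma dim_ge_trans V W X n1 n2 : W `<=` V -> X `<=` W -> subspace W ->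
  dim_ge V W n1 -> dim_ge W X n2 -> dim_ge V X (n1 + n2).
Proof.
move=> WV XW sW [e1 [Ve1 fe1]] [e2 [We2 fe2]].
exists (fun i : 'I_(_ + _) => match fintype.split i with inl j => e1 j | inr k => e2 k end).
split=> [i|c]; first by case: fintype.split => j //; apply: WV.
rewrite big_split_ord /=.
under eq_bigr do rewrite (unsplitK (inl _)).
under [X in _ + X]eq_bigr do rewrite (unsplitK (inr _)).
move=> Xc.
have W2 : W (\sum_i iota (c (rshift n1 i)) * e2 i).
  by apply: subspace_sum => // i _; case: sW => _ _; apply.
have c1 : forall i, c (lshift n2 i) = 0.
  by apply: (fe1 (fun i => c (lshift n2 i)));
    rewrite -[X in W X](addrK (\sum_i iota (c (rshift n1 i)) * e2 i));
      apply: subspaceB => //; apply: XW.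
have c2 : forall i, c (rshift n1 i) = 0.
  apply: (fe2 (fun i => c (rshift n1 i))); move: Xc; congr (X _).
  by rewrite big1 ?add0r // => i _; rewrite c1 rmorph0 mul0r.
by move=> i; rewrite -[i]splitK; case: fintype.split => j; [exact: c1 | exact: c2].
Qed.

Lemma dim_le_trans V W X d1 d2 : dim_le V W d1 -> dim_le W X d2 -> dim_le V X (d1 + d2).
Proof.
move=> [e1 s1] [e2 s2].
exists (fun i : 'I_(_ + _) => match fintype.split i with inl j => e1 j | inr k => e2 k end) => z.
case/s1 => c1 /s2[c2 Xc].
exists (fun i : 'I_(_ + _) => match fintype.split i with inl j => c1 j | inr k => c2 k end).
rewrite big_split_ord /=.
under eq_bigr do rewrite (unsplitK (inl _)).
under [X in _ - (_ + X)]eq_bigr do rewrite (unsplitK (inr _)).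
by rewrite opprD addrA.
Qed.

(** A free family of greatest length spans: z is adjoined to it as the value at [None], and the
    resulting relation must involve z. *)
Lemma quotient_basis_exists V W d : subspace V -> subspace W ->
  (forall n, dim_ge V W n -> (n <= d)%N) ->
  exists n (e : 'I_n -> F), quotient_basis iota V W e.
Proof.
move=> sV sW bnd.
have ex0 : exists n, `[< dim_ge V W n >].
  by exists 0%N; apply/asboolP; exists (fun=> 0); split=> [[]|c _ []].
have bnd' n : `[< dim_ge V W n >] -> (n <= d)%N by move/asboolP; apply: bnd.
case: (ex_maxnP ex0 bnd') => n /asboolP[e [Ve fe]] maxn.
exists n, e; split=> // z Vz.
pose e' (i : option 'I_n) := if i is Some j then e j else z.
have [c [Wc cN0]] : exists c : option 'I_n -> K,
    W (\sum_i iota (c i) * e' i) /\ c None != 0.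
  apply: contrapT => /forallNP noc.
  suff /dim_geP : free_family V W e'.
    by rewrite card_option card_ord => /asboolP/maxn; rewrite ltnn.
  split=> [[i|]|c Wc]; [exact: Ve | exact: Vz |].
  have cN : c None = 0 by apply/eqP; rewrite -[_ == _]negbK; apply/negP => c0; case: (noc c).
  case=> // i; apply: (fe (fun j => c (Some j))); move: Wc; congr (W _).
  rewrite (bigD1 None) //= cN rmorph0 mul0r add0r.
  rewrite (reindex_omap Some (fun x => x)) //=; last by case.
  by apply: eq_bigl => j /=; rewrite eqxx.
pose b := [ffun i => - (c (Some i) / c None)].
have Wb : W (z - \sum_i iota (b i) * e i).
  have [_ _ /(_ (c None)^-1 _ Wc)] := sW; congr (W _).
  rewrite (bigD1 None) //= mulrDr mulrA -rmorphM mulVf // rmorph1 mul1r; congr (_ + _).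
  rewrite (reindex_omap Some (fun x => x)) //=; last by case.
  rewrite mulr_sumr -sumrN; apply: eq_big => [j|j _]; first by rewrite /= eqxx.
  by rewrite ffunE rmorphN mulNr opprK mulrA -rmorphM [_ / _]mulrC.
exists b; split=> // b' Wb'; apply/ffunP => i.
apply/eqP; rewrite -subr_eq0; apply/eqP; move: i.
apply: (fe (fun i => b i - b' i)).
have := subspaceB sW Wb' Wb; congr (W _).
under [RHS]eq_bigr do rewrite rmorphB mulrBl.
by rewrite sumrB; ring.
Qed.

Lemma quotient_basis_dim_ge V W n (e : 'I_n -> F) : V 0 -> subspace W ->
  quotient_basis iota V W e -> dim_ge V W n.
Proof.
move=> V0 sW [Ve be]; exists e; split=> // c Wc i.
(* Independence comes from the uniqueness of the coordinates of 0. *)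
have [b [_ ub]] := be 0 V0.
have b0 : b = [ffun=> 0].
  apply: ub; rewrite big1; first by rewrite subr0; case: sW.
  by move=> j _; rewrite ffunE rmorph0 mul0r.
have : b = [ffun j => - c j].
  apply: ub; move: Wc; congr (W _); rewrite sub0r -sumrN.
  by apply: eq_bigr => j _; rewrite ffunE rmorphN mulNr opprK.
by rewrite b0 => /ffunP/(_ i); rewrite !ffunE => /eqP; rewrite eq_sym oppr_eq0 => /eqP.
Qed.

Lemma quotient_basis_dim_le V W n (e : 'I_n -> F) :
  quotient_basis iota V W e -> dim_le V W n.
Proof. by case=> _ be; exists e => z /be[c [Wc _]]; exists c. Qed.

Lemma quotient_basis_dim V W n (e : 'I_n -> F) : V 0 -> subspace W ->
  quotient_basis iota V W e -> quotient_dim iota V W = n.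
Proof.
move=> V0 sW be; rewrite /quotient_dim; apply: xget_subset1; first by exists e.
move=> i j [ei bi] [ej bj].
apply/eqP; rewrite eqn_leq (dim_ge_le sW (quotient_basis_dim_ge V0 sW bi)
  (quotient_basis_dim_le bj)).
exact: dim_ge_le sW (quotient_basis_dim_ge V0 sW bj) (quotient_basis_dim_le bi).
Qed.

Lemma quotient_dimP V W d : subspace V -> subspace W ->
    (forall n, dim_ge V W n -> (n <= d)%N) ->
  exists e : 'I_(quotient_dim iota V W) -> F, quotient_basis iota V W e.
Proof.
move=> sV sW /(quotient_basis_exists sV sW)[n [e be]].
by have [V0 _ _] := sV; rewrite (quotient_basis_dim V0 sW be); exists e.
Qed.

Lemma quotient_dim_eq V W d : subspace V -> subspace W ->
  dim_ge V W d -> dim_le V W d -> quotient_dim iota V W = d.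
Proof.
move=> sV sW ged led.
have [n ge_n|e be] := @quotient_dimP V W d sV sW; first exact: dim_ge_le led.
have [V0 _ _] := sV.
apply/eqP; rewrite eqn_leq (dim_ge_le sW (quotient_basis_dim_ge V0 sW be) led).
exact: dim_ge_le (quotient_basis_dim_le be).
Qed.

End QuotientDimension.

(** * Valuations *)

Section Valuations.
Variables (K F : fieldType) (iota : {rmorphism K -> F}).
Implicit Types (P Q : place iota) (z w : F).

(* The condition v_P(z) >= k, with the convention v_P(0) = +oo. *)
Definition vge P z (k : int) : Prop := z != 0 -> k <= P z.

Lemma val_one P : P 1 = 0.
Proof. by rewrite -(rmorph1 iota) val_atK ?oner_neq0. Qed.

Lemma val_opp P z : P (- z) = P z.
Proof.
have [->|z0] := eqVneq z 0; first by rewrite oppr0.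
have N1 : (-1 : F) = iota (-1) by rewrite rmorphN1.
by rewrite -mulN1r val_atM ?oppr_eq0 ?oner_neq0 // N1 val_atK ?oppr_eq0 ?oner_neq0 // add0r.
Qed.

Lemma val_inv P z : P z^-1 = - P z.
Proof.
have [->|z0] := eqVneq z 0; first by rewrite invr0 val_at0 oppr0.
by apply/eqP; rewrite -addr_eq0 -val_atM ?invr_eq0 // mulVf // val_one.
Qed.

Lemma val_div P z w : z != 0 -> w != 0 -> P (z / w) = P z - P w.
Proof. by move=> z0 w0; rewrite val_atM ?invr_eq0 // val_inv. Qed.

Lemma val_exp P z n : P (z ^+ n) = P z *+ n.
Proof.
have [->|z0] := eqVneq z 0; first by case: n => [|n];
  rewrite ?expr0 ?val_one // expr0n val_at0 mul0rn.
by elim: n => [|n IH]; rewrite ?expr0 ?val_one // exprS mulrS val_atM ?expf_neq0 // IH.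
Qed.

Lemma vge0 P k : vge P 0 k.
Proof. by rewrite /vge eqxx. Qed.

Lemma vgeW P z k k' : k' <= k -> vge P z k -> vge P z k'.
Proof. by move=> le_k zk /zk; apply: le_trans. Qed.

Lemma vge_refl P z : vge P z (P z).
Proof. by move=> _. Qed.

Lemma vgeD P z w k : vge P z k -> vge P w k -> vge P (z + w) k.
Proof.
have [->|z0] := eqVneq z 0; first by rewrite add0r.
have [->|w0] := eqVneq w 0; first by rewrite addr0.
move=> /(_ z0) zk /(_ w0) wk zw0; apply: (le_trans _ (val_atD P z0 w0 zw0)).
by rewrite le_min zk.
Qed.

Lemma vgeN P z k : vge P z k -> vge P (- z) k.
Proof. by rewrite /vge val_opp oppr_eq0. Qed.

Lemma vgeB P z w k : vge P z k -> vge P w k -> vge P (z - w) k.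
Proof. by move=> zk wk; apply: vgeD => //; apply: vgeN. Qed.

Lemma vgeM P z w k k' : vge P z k -> vge P w k' -> vge P (z * w) (k + k').
Proof.
move=> zk wk; rewrite /vge mulf_eq0 negb_or => /andP[z0 w0].
by rewrite val_atM // lerD // ?zk ?wk.
Qed.

Lemma vgeK P c : vge P (iota c) 0.
Proof. by rewrite /vge fmorph_eq0 => /val_atK->. Qed.

Lemma vgeZ P c z k : vge P z k -> vge P (iota c * z) k.
Proof. by move=> zk; rewrite -[k]add0r; apply: vgeM => //; apply: vgeK. Qed.

Lemma vgeX P z n : vge P z 0 -> vge P (z ^+ n) 0.
Proof.
move=> z0; elim: n => [|n IH]; first by rewrite expr0 -(rmorph1 iota); apply: vgeK.
by rewrite exprS -[0]addr0; apply: vgeM.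
Qed.

Lemma vge_sum P (I : Type) (r : seq I) (Q : pred I) (f : I -> F) k :
  (forall i, Q i -> vge P (f i) k) -> vge P (\sum_(i <- r | Q i) f i) k.
Proof.
move=> fk; elim/big_ind: _ => //; first exact: vge0.
by move=> *; apply: vgeD.
Qed.

Lemma vge_subspace P k : subspace iota [set z | vge P z k].
Proof. split=> [|z w|c z]; [exact: vge0|exact: vgeD|exact: vgeZ]. Qed.

Lemma vge_eq0 P z : (forall k, vge P z k) -> z = 0.
Proof.
move=> zk; apply/eqP; rewrite -[_ == _]negbK; apply/negP => /(zk (P z + 1)).
by rewrite gerDl.
Qed.

(** The strict triangle inequality. Writing the hypothesis with [vge] lets w be 0. *)
Lemma val_add_lt P z w : z != 0 -> vge P w (P z + 1) -> z + w != 0 /\ P (z + w) = P z.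
Proof.
move=> z0 wk.
have zw0 : z + w != 0.
  apply/negP; rewrite addr_eq0 => /eqP zw; move: wk; rewrite /vge -oppr_eq0 -zw => /(_ z0).
  by rewrite zw val_opp gerDl.
split=> //; apply/eqP; rewrite eq_le; apply/andP; split; last first.
  have := @vgeD P z w (P z) (@vge_refl _ _); apply=> //; apply: vgeW wk.
  by rewrite lerDl.
rewrite leNgt; apply/negP => lt.
have : vge P z (P z + 1).
  rewrite -[X in vge P X _](addrK w); apply: vgeB => //.
  by move=> _; rewrite -ltzD1 ltrD2r.
by move/(_ z0); rewrite gerDl.
Qed.

(** The least valuation is attained by a single nonzero term, so nothing can cancel it. At totally
    ramified places this turns a bound on a sum into bounds on its terms. *)
Lemma vge_sum_distinct P (I : finType) (f : I -> F) k :
  (forall i j, i != j -> f i != 0 -> f j != 0 -> P (f i) != P (f j)) ->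
  vge P (\sum_i f i) k -> forall i, vge P (f i) k.
Proof.
move=> dst sk i fi0; rewrite leNgt; apply/negP => lt.
have [i1 fi1 min_i] := arg_minP (fun i => P (f i)) (P := fun i => f i != 0) (i0 := i) fi0.
move: sk; rewrite (bigD1 i1) //= => sk.
have [|] := @val_add_lt P (f i1) (\sum_(j | j != i1) f j) fi1.
  apply: vge_sum => j ji1 fj0; have := min_i j fj0; rewrite le_eqVlt (negPf (dst _ _ _ _ _)) //.
    by rewrite -ltzD1 ltrD2r.
  by rewrite eq_sym.
move=> s0 Ps; have := sk s0; rewrite Ps => le_k.
by have := lt_le_trans lt (le_trans le_k (min_i i fi0)); rewrite ltxx.
Qed.

Lemma free_distinct P (I : finType) (e : I -> F) :
  (forall i, e i != 0) -> (forall i j, i != j -> P (e i) != P (e j)) ->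
  free_mod iota [set 0] e.
Proof.
move=> e0 dst c /= ce i; apply/eqP.
suff : iota (c i) * e i == 0 by rewrite mulf_eq0 (negPf (e0 i)) orbF fmorph_eq0.
apply/eqP; apply: (@vge_eq0 P) => k; move: i.
apply: vge_sum_distinct => [i j ij|]; last by rewrite ce; apply: vge0.
rewrite !mulf_eq0 !negb_or !fmorph_eq0 => /andP[ci _] /andP[cj _].
by rewrite !val_atM ?fmorph_eq0 // !val_atK // !add0r dst.
Qed.

(** At a pole of z, the power z^n would have a pole of higher order than every term on the right. *)
Lemma vge_integral P z n (a : 'I_n -> F) : (forall i, vge P (a i) 0) ->
  z ^+ n = \sum_(i < n) a i * z ^+ i -> vge P z 0.
Proof.
move=> a0 zn z0; rewrite leNgt; apply/negP => lt0.
have : vge P (z ^+ n) (P z *+ n + 1).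
  rewrite zn; apply: vge_sum => i _.
  apply: (@vgeW _ _ (0 + P z *+ i)); last by apply: vgeM => //; rewrite -val_exp; apply: vge_refl.
  have := ltn_ord i; nia.
by move/(_ (expf_neq0 _ z0)); rewrite val_exp gerDl.
Qed.

Lemma val_sub_const P z c d : c != d -> 0 < P (z - iota c) -> z - iota d != 0 /\ P (z - iota d) = 0.
Proof.
move=> cd lt0.
have cd0 : iota (c - d) != 0 by rewrite fmorph_eq0 subr_eq0.
have := @val_add_lt P (iota (c - d)) (z - iota c) cd0.
have -> : iota (c - d) + (z - iota c) = z - iota d by rewrite rmorphB; ring.
rewrite val_atK ?subr_eq0 //; apply.
by move=> _; rewrite add0r -gtz0_ge1.
Qed.

Lemma place_eq P Q : (forall z, P z = Q z) -> P = Q.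
Proof.
case: P Q => [f f0 fM fD fK f1] [g g0 gM gD gK g1] /= /funext fg; subst g.
by congr Place; apply: Prop_irrelevance.
Qed.

End Valuations.

(** * Existence of places *)

Section Chevalley.
Variable F : fieldType.
Implicit Types (O J : set F).

Definition ring_set O : Prop :=
  [/\ O 1, forall z w, O z -> O w -> O (z - w) & forall z w, O z -> O w -> O (z * w)].

Definition ideal_in O J : Prop :=
  [/\ J `<=` O, J 0, forall z w, J z -> J w -> J (z - w)
     & forall z w, O z -> J w -> J (z * w)].

Definition nonunits O : set F := [set z | O z /\ (z = 0 \/ ~ O z^-1)].

(** For a ring O this is O[z]; with an ideal J as set of coefficients it is the extended ideal J
    O[z]. *)
Definition poly_values O (z : F) : set F :=
  [set w | exists2 G : {poly F}, (forall i, O G`_i) & w = G.[z]].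

Lemma ring_set0 O : ring_set O -> O 0.
Proof. by case=> O1 OB _; rewrite -(subrr 1); apply: OB. Qed.

Lemma ring_setD O z w : ring_set O -> O z -> O w -> O (z + w).
Proof.
move=> rO; have O0 := ring_set0 rO; case: rO => O1 OB _ Oz Ow;
  have -> : z + w = z - (0 - w) by rewrite sub0r opprK.
by apply: (OB) => //; apply: (OB).
Qed.

Lemma ring_set_sum O (I : Type) (r : seq I) (Q : pred I) (f : I -> F) :
  ring_set O -> (forall i, Q i -> O (f i)) -> O (\sum_(i <- r | Q i) f i).
Proof.
move=> rO Of; elim/big_ind: _ => //; first exact: ring_set0.
by move=> *; apply: ring_setD.
Qed.

Lemma ring_setX O z n : ring_set O -> O z -> O (z ^+ n).
Proof. by case=> O1 _ OM Oz; elim: n => [|n IH]; rewrite ?expr0 // exprS; apply: OM. Qed.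

Lemma idealD O J z w : ideal_in O J -> J z -> J w -> J (z + w).
Proof.
case=> _ J0 JB _ Jz Jw; have -> : z + w = z - (0 - w) by rewrite sub0r opprK.
by apply: (JB) => //; apply: (JB).
Qed.

Lemma ideal_sum O J (I : Type) (r : seq I) (Q : pred I) (f : I -> F) :
  ideal_in O J -> (forall i, Q i -> J (f i)) -> J (\sum_(i <- r | Q i) f i).
Proof.
move=> iJ Jf; elim/big_ind: _ => // [|z w]; last exact: idealD iJ.
by case: iJ.
Qed.

Lemma ring_set_poly_values O z : ring_set O -> ring_set (poly_values O z).
Proof.
move=> rO; have O0 := ring_set0 rO; have [O1 OB OM] := rO; split.
- by exists 1; rewrite ?hornerC // => i; rewrite coef1; case: (i == 0)%N.
- move=> _ _ [G OG ->] [H OH ->]; exists (G - H); last by rewrite hornerD hornerN.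
  by move=> i; rewrite coefB; apply: OB.
- move=> _ _ [G OG ->] [H OH ->]; exists (G * H); last by rewrite hornerM.
  by move=> i; rewrite coefM; apply: ring_set_sum => // j _; apply: OM.
Qed.

Lemma poly_values_sub O z : O 0 -> O `<=` poly_values O z.
Proof.
move=> O0 w Ow; exists w%:P; last by rewrite hornerC.
by move=> i; rewrite coefC; case: (i == 0)%N.
Qed.

Lemma poly_values_gen O z : ring_set O -> poly_values O z z.
Proof.
move=> rO; have O0 := ring_set0 rO; have [O1 _ _] := rO; exists 'X; last by rewrite hornerX.
by move=> i; rewrite coefX; case: (i == 1)%N.
Qed.

Lemma ideal_poly_values O J z : ring_set O -> ideal_in O J ->
  ideal_in (poly_values O z) (poly_values J z).
Proof.
move=> rO iJ; have [JO J0 JB JM] := iJ; split.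
- by move=> _ [G JG ->]; exists G => // i; apply: JO.
- by exists 0; rewrite ?horner0 // => i; rewrite coef0.
- move=> _ _ [G JG ->] [H JH ->]; exists (G - H); last by rewrite hornerD hornerN.
  by move=> i; rewrite coefB; apply: JB.
- move=> _ _ [G OG ->] [H JH ->]; exists (G * H); last by rewrite hornerM.
  by move=> i; rewrite coefM; apply: ideal_sum iJ _ => j _; apply: JM.
Qed.

Record proper_pair := ProperPair {
  pp_ring : set F; pp_ideal : set F;
  pp_ringP : ring_set pp_ring;
  pp_idealP : ideal_in pp_ring pp_ideal;
  pp_proper : ~ pp_ideal 1 }.

Definition pp_le (p q : proper_pair) : bool :=
  `[< pp_ring p `<=` pp_ring q /\ pp_ideal p `<=` pp_ideal q >].

Lemma maximal_pair (p0 : proper_pair) :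
  exists p, pp_le p0 p /\ forall q, pp_le p q -> pp_le q p.
Proof.
have le_refl p : pp_le p p by apply/asboolP; split.
have le_tr p q r : pp_le p q -> pp_le q r -> pp_le p r.
  move=> /asboolP[a b] /asboolP[c d]; apply/asboolP; split.
    exact: subset_trans c.
  exact: subset_trans d.
(* Restricting to the pairs above [p0] provides a bound for the empty chain. *)
pose T := {p | pp_le p0 p}.
pose R (p q : T) := pp_le (sval p) (sval q).
have [t|r s t||[p le_p] maxp] := @ZL_preorder T (exist _ p0 (le_refl p0)) R.
- exact: (le_refl (sval t)).
- exact: (le_tr (sval r) (sval s) (sval t)).
- move=> A totA; have [[q0 Aq0]|noA] := pselect (exists q, A q); last first.
    by exists (exist _ p0 (le_refl p0)) => s As; case: noA; exists s.
  pose O := [set z | exists2 q, A q & pp_ring (sval q) z].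
  pose J := [set z | exists2 q, A q & pp_ideal (sval q) z].
  have join q r : A q -> A r -> exists s, [/\ A s, R q s & R r s].
    by move=> Aq Ar; have [qr|rq] := totA q r Aq Ar; [exists r|exists q]; split;
      rewrite // /R le_refl.
  have rO : ring_set O.
    split; first by exists q0 => //; case: (pp_ringP (sval q0)).
      move=> z w [q Aq qz] [r Ar rw]; have [s [As /asboolP[qs _] /asboolP[rs _]]] := join q r Aq Ar.
      by exists s => //; case: (pp_ringP (sval s)) => _ sB _; apply: sB; [apply: qs|apply: rs].
    move=> z w [q Aq qz] [r Ar rw]; have [s [As /asboolP[qs _] /asboolP[rs _]]] := join q r Aq Ar.
    by exists s => //; case: (pp_ringP (sval s)) => _ _ sM; apply: sM; [apply: qs|apply: rs].
  have iJ : ideal_in O J.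
    split.
    - by move=> z [q Aq qz]; exists q => //; case: (pp_idealP (sval q)) => JO _ _ _; apply: JO.
    - by exists q0 => //; case: (pp_idealP (sval q0)).
    - move=> z w [q Aq qz] [r Ar rw]; have [s [As /asboolP[_ qs] /asboolP[_ rs]]] := join q r Aq Ar.
      by exists s => //; case: (pp_idealP (sval s)) => _ _ sB _; apply: sB; [apply: qs|apply: rs].
    move=> z w [q Aq qz] [r Ar rw]; have [s [As /asboolP[qs _] /asboolP[_ rs]]] := join q r Aq Ar.
    by exists s => //; case: (pp_idealP (sval s)) => _ _ _ sM; apply: sM; [apply: qs|apply: rs].
  have nJ1 : ~ J 1 by case=> q _; apply: pp_proper.
  pose u := ProperPair rO iJ nJ1.
  have le_u q : A q -> pp_le (sval q) u.
    by move=> Aq; apply/asboolP; split=> z qz; exists q.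
  exists (exist _ u (le_tr _ _ _ (svalP q0) (le_u q0 Aq0))).
  exact: le_u.
exists p; split=> // q pq.
exact: (maxp (exist _ q (le_tr _ _ _ le_p pq)) pq).
Qed.

Section Maximal.
Variables (O J : set F) (rO : ring_set O) (iJ : ideal_in O J) (nJ1 : ~ J 1).
Hypothesis maxO : forall z, ~ poly_values J z 1 -> O z.

(** With s = 1 - b, [maxO] reduces the claim to excluding 1 = G(1/s) with coefficients in J.
    Clearing denominators would put a power of s in J, but s is 1 modulo J and J is proper. *)
Lemma maximal_local b : J b -> O (1 - b)^-1.
Proof.
move=> Jb; have [JO J0 JB JM] := iJ; have [O1 OB OM] := rO.
apply: maxO => -[G JG]; set s := 1 - b => sG.
have s0 : s != 0 by rewrite /s subr_eq0; apply/negP => /eqP b1; apply: nJ1; rewrite b1.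
have Os : O s by apply: OB => //; apply: JO.
have Js : J (s ^+ size G).
  rewrite -[s ^+ _]mulr1 sG horner_coef mulr_sumr; apply: ideal_sum iJ _ => i _.
  rewrite mulrCA mulrC exprVn -expfB //; apply: JM => //.
  exact: ring_setX.
suff : forall n, J (1 - s ^+ n).
  move/(_ (size G)) => J1s; apply: nJ1.
  by rewrite -[1](subrK (s ^+ size G)); apply: idealD iJ _ _.
elim=> [|n IH]; first by rewrite expr0 subrr.
have -> : 1 - s ^+ n.+1 = (1 - s ^+ n) - (- s ^+ n * b) by rewrite exprSr /s; ring.
by apply: (JB) => //; apply: (JM) => //; rewrite -sub0r; apply: OB; [apply: JO|apply: ring_setX].
Qed.

(** If both failed, maximality would give relations 1 = G(z) and 1 = H(1/z) with coefficients in J;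
    the one of higher degree can always be shortened by the other, which is a descent on
    [size G + size H]. *)
Lemma maximal_valuation z : O z \/ O z^-1.
Proof.
have [JO J0 JB JM] := iJ; have [O1 OB OM] := rO.
have [z0|z0] := eqVneq z 0; first by left; rewrite z0; apply: JO.
suff key N : forall (w : F) (G H : {poly F}), w != 0 -> (size G + size H <= N)%N ->
    (forall i, J G`_i) -> (forall i, J H`_i) -> G.[w] = 1 -> H.[w^-1] = 1 -> False.
  apply: contrapT => /not_orP[nz nzi].
  have /contrapT[G JG G1] := contra_not (@maxO z) nz.
  have /contrapT[H JH H1] := contra_not (@maxO z^-1) nzi.
  exact: (key _ z G H z0 (leqnn _)).
elim: N => [|N IH] w G H w0.
  by rewrite leqn0 addn_eq0 !size_poly_eq0 => /andP[/eqP-> _] _ _; rewrite horner0 => /eqP;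
    rewrite eq_sym oner_eq0.
wlog le_HG : w G H w0 / (size H <= size G)%N => [wl|] le_N JG JH G1 H1.
  have [/wl|/ltnW le_GH] := leqP (size H) (size G); first by move=> /(_ w w0); apply.
  by apply: (wl w^-1 H G); rewrite ?invr_eq0 ?invrK // addnC.
have [n sG] : exists n, size G = n.+1.
  case: (size G) (size_poly_eq0 G) => [|n _]; last by exists n.
  by rewrite eqxx => /esym/eqP G0; move: G1; rewrite G0 horner0 => /eqP; rewrite eq_sym oner_eq0.
have [k sH] : exists k, size H = k.+1.
  case: (size H) (size_poly_eq0 H) => [|k _]; last by exists k.
  by rewrite eqxx => /esym/eqP G0; move: H1; rewrite G0 horner0 => /eqP; rewrite eq_sym oner_eq0.
have le_kn : (k <= n)%N by rewrite -ltnS -sG -sH.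
pose s := 1 - H`_0.
have Os : O s^-1 by apply: maximal_local.
have s0 : s != 0 by rewrite /s subr_eq0; apply/negP => /eqP b1; apply: nJ1; rewrite b1.
(* The relation for 1/w, multiplied by w^n / s, expresses w^n by lower powers with coefficients in
   J; substituting it in G gives [G']. *)
have wn : w ^+ n = \sum_(i < k) (s^-1 * H`_i.+1) * w ^+ (n - i.+1).
  have : s = \sum_(i < k) H`_i.+1 * w^-1 ^+ i.+1.
    by rewrite /s -{1}H1 horner_coef sH big_ord_recl expr0 mulr1 addrAC subrr add0r.
  move=> /(congr1 (fun v => s^-1 * v * w ^+ n)); rewrite mulVf // mul1r => ->.
  rewrite mulr_sumr mulr_suml; apply: eq_bigr => i _.
  have le_in : (i.+1 <= n)%N by apply: leq_trans le_kn.
  by rewrite expfB_cond ?(negPf w0) // exprVn !mulrA -!mulrA [_ * w ^+ n]mulrC !mulrA.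
pose G' := \poly_(i < n) (G`_i + if (n - i <= k)%N then G`_n * (s^-1 * H`_(n - i)) else 0).
apply: (IH w G' H) => //.
- by have := size_poly n (fun i => G`_i + if (n - i <= k)%N then G`_n * (s^-1 * H`_(n - i))
  else 0); rewrite -/G'; lia.
- move=> i; rewrite coef_poly; case: ltnP => // _.
  apply: (idealD iJ (JG i)).
  by case: ifP => // _; apply: (JM); [apply: JO|apply: (JM)].
rewrite -G1 [RHS]horner_coef sG big_ord_recr /= wn horner_poly.
under [LHS]eq_bigr do rewrite mulrDl.
rewrite big_split /=; congr (_ + _).
rewrite (reindex_inj rev_ord_inj) /= mulr_sumr.
rewrite (bigID (fun i : 'I_n => (i < k)%N)) /= [X in _ + X]big1 ?addr0 => [|i].
  rewrite [RHS](big_ord_widen n (fun i => G`_n * (s^-1 * H`_i.+1 * w ^+ (n - i.+1)))) //.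
  by apply: eq_bigr => i ik; rewrite subKn // ik !mulrA.
by rewrite subKn // -ltnNge ltnS => ik; rewrite leqNgt ltnS ik mul0r.
Qed.

End Maximal.

Lemma chevalley R I : ring_set R -> ideal_in R I -> ~ I 1 ->
  exists O, [/\ ring_set O, R `<=` O, forall z, O z \/ O z^-1 & I `<=` nonunits O].
Proof.
move=> rR iI nI1.
have [[O J rO iJ nJ] [/asboolP[/= RO IJ] maxO]] := maximal_pair (ProperPair rR iI nI1).
have [JO J0 JB JM] := iJ.
exists O; split=> //.
  apply: (maximal_valuation rO iJ nJ) => z nz1.
  have := maxO (ProperPair (ring_set_poly_values z rO) (ideal_poly_values z rO iJ) nz1).
  rewrite /pp_le /= => /(_ _)/asboolP[|+ _].
    by apply/asboolP; split; apply: poly_values_sub => //; apply: ring_set0.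
  by apply; apply: poly_values_gen.
move=> z /IJ Jz; split; first exact: JO.
have [->|z0] := eqVneq z 0; [by left|right => Ozi].
by apply: (nJ); rewrite -(mulVf z0); apply: JM.
Qed.

End Chevalley.

(** * Evaluation of polynomials and independence over K(t) *)

Lemma poly_split (R : comNzRingType) (p : {poly R}) : p = (p`_0)%:P + 'X * drop_poly 1 p.
Proof.
have := poly_take_drop 1 p; rewrite expr1 mulrC => {1}<-; congr (_ + _).
by apply/polyP => i; rewrite coef_take_poly coefC; case: i.
Qed.

Section PolynomialValues.
Variables (R : nzRingType) (F : fieldType) (f : {rmorphism R -> F}).

(** R is an arbitrary ring so that evaluation can be iterated: [peval (peval iota x) y] evaluates at
    y a polynomial whose coefficients are polynomials in x. *)
Definition peval (t : F) : {poly R} -> F := horner_eval t \o map_poly f.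

HB.instance Definition _ (t : F) := GRing.RMorphism.copy (peval t) (horner_eval t \o map_poly f).

Lemma pevalC t c : peval t c%:P = f c.
Proof. by rewrite /peval /= /horner_eval map_polyC hornerC. Qed.

Lemma pevalX t : peval t 'X = t.
Proof. by rewrite /peval /= /horner_eval map_polyX hornerX. Qed.

Lemma pevalXsubC t c : peval t ('X - c%:P) = t - f c.
Proof. by rewrite rmorphB /= pevalC pevalX. Qed.

Lemma peval_widen t (p : {poly R}) n : (size p <= n)%N -> peval t p = \sum_(i < n) f p`_i * t ^+ i.
Proof.
move=> le_pn; rewrite /peval /= /horner_eval (horner_coef_wide _ (n := n)); last first.
  exact: leq_trans (size_poly _ _) le_pn.
by apply: eq_bigr => i _; rewrite coef_map.
Qed.

Lemma peval_sum t (p : {poly R}) : peval t p = \sum_(i < size p) f p`_i * t ^+ i.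
Proof. exact: peval_widen. Qed.

End PolynomialValues.

Section PolynomialIndependence.
Variables (K F : fieldType) (iota : {rmorphism K -> F}).
Local Notation peval := (peval iota).

Lemma peval_eq0 t p : ~ algebraicOver iota t -> (peval t p == 0) = (p == 0).
Proof.
move=> tr; apply/eqP/eqP => [pt|->]; last by rewrite rmorph0.
apply/eqP; rewrite -[_ == _]negbK; apply/negP => p0.
by apply: tr; exists p => //; apply/rootP.
Qed.

(** For t transcendental this is linear independence over K(t), by clearing denominators. *)
Definition indep (t : F) (I : finType) (z : I -> F) : Prop :=
  forall phi : I -> {poly K}, \sum_i peval t (phi i) * z i = 0 -> forall i, phi i = 0.

(* For t transcendental: [F : K(t)] <= N. *)
Definition deg_le (t : F) (N : nat) : Prop :=
  forall n (z : 'I_n -> F), indep t z -> (n <= N)%N.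

End PolynomialIndependence.

(** * From a valuation ring to a normalized discrete valuation *)

Section DiscretePlace.
Variables (K F : fieldType) (iota : {rmorphism K -> F}) (O : set F).
Hypotheses (rO : ring_set O) (valO : forall z, O z \/ O z^-1)
  (KO : forall c, O (iota c)).
Local Notation M := (nonunits O).
Local Notation peval := (peval iota).

Let unitO : set F := [set z | [/\ z != 0, O z & O z^-1]].

Let OM z w : O z -> O w -> O (z * w).
Proof. by case: rO => _ _; apply. Qed.

Let MO z : M z -> O z.
Proof. by case. Qed.

Let notMV z : z != 0 -> O z^-1 -> ~ M z.
Proof. by move=> z0 Ozi [_ []//]; apply/eqP. Qed.

Let unit_or z : O z -> M z \/ unitO z.
Proof.
move=> Oz; have [->|z0] := eqVneq z 0; first by left; split; [apply: ring_set0|left].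
by have [Ozi|nOzi] := pselect (O z^-1); [right|left; split=> //; right].
Qed.

Let unit_notM z : unitO z -> ~ M z.
Proof. by case=> z0 _ Ozi; apply: notMV. Qed.

Let MZ a z : O a -> M z -> M (a * z).
Proof.
move=> Oa Mz; have Oz := MO Mz; split; first exact: OM.
have [->|az0] := eqVneq (a * z) 0; [by left|right => Oi].
have [a0 z0] : a != 0 /\ z != 0 by apply/andP; rewrite -negb_or -mulf_eq0.
apply: (notMV z0 _ Mz); have -> : z^-1 = a * (a * z)^-1 by rewrite invfM mulVKf.
exact: OM.
Qed.

Let MD z w : M z -> M w -> M (z + w).
Proof.
wlog Ozw : z w / O (z / w) => [wl|] Mz Mw.
  have [/wl|] := valO (z / w); first exact.
  by rewrite invf_div => /wl; rewrite addrC; apply.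
have [w0|w0] := eqVneq w 0; first by rewrite w0 addr0.
have -> : z + w = (z / w + 1) * w by rewrite mulrDl divfK // mul1r.
by apply: MZ => //; apply: ring_setD => //; case: rO.
Qed.

Let unit1 : unitO 1.
Proof. by split; rewrite ?invr1 ?oner_neq0 //; case: rO. Qed.

Let unitM z w : unitO z -> unitO w -> unitO (z * w).
Proof. by move=> [z0 Oz Ozi] [w0 Ow Owi]; split; rewrite ?mulf_neq0 ?invfM //; apply: OM. Qed.

Let unitV z : unitO z -> unitO z^-1.
Proof. by case=> *; split; rewrite ?invrK ?invr_eq0. Qed.

Let unitDM z w : unitO z -> M w -> unitO (z + w).
Proof.
move=> uz Mw; have [|//] : M (z + w) \/ unitO (z + w).
  by apply: unit_or; apply: ring_setD => //; [case: uz|apply: MO].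
move=> Mzw; case: (unit_notM uz); rewrite -[z](addrK w); apply: MD => //.
by rewrite -mulN1r; apply: MZ => //; rewrite -(rmorphN1 iota).
Qed.

Let unitK c : c != 0 -> unitO (iota c).
Proof. by move=> c0; split; rewrite ?fmorph_eq0 // -fmorphV. Qed.

Let notO_M z : ~ O z -> M z^-1.
Proof.
move=> nOz; have [//|Ozi] := valO z; split=> //; right; by rewrite invrK.
Qed.

Let OX z n : O z -> O (z ^+ n).
Proof. exact: ring_setX. Qed.

Lemma valuation_ring_peval t p : O t -> O (peval t p).
Proof.
move=> Ot; rewrite peval_sum; apply: ring_set_sum => // i _.
by apply: OM => //; apply: OX.
Qed.

(** The sum is a unit times a term that strictly divides the other nonzero terms. As no
    integer-valued valuation is available yet, this term is found as the one strictly dividing the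
    greatest number of terms. *)
Lemma dominated_sum (I : finType) (w : I -> F) (i0 : I) : w i0 != 0 ->
  (forall i j, i != j -> w i != 0 -> w j != 0 -> M (w i / w j) \/ M (w j / w i)) ->
  \sum_i w i != 0.
Proof.
move=> wi0 cmp.
pose S i := [set j | (w j != 0) && `[< M (w j / w i) >]]%SET.
have [i wi maxi] := @arg_maxnP I i0 (fun i => w i != 0) (fun i => #|S i|) wi0.
have dom j : j != i -> w j != 0 -> M (w j / w i).
  move=> ji wj; have [//|Mij] := cmp j i ji wj wi.
  have : (#|S i| < #|S j|)%N.
    apply: proper_card; apply/properP; split.
      apply/fintype.subsetP => k; rewrite !inE => /andP[-> /asboolP Mki] /=; apply/asboolP.
      have -> : w k / w j = (w i / w j) * (w k / w i) by field; rewrite wi wj.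
      by apply: MZ => //; apply: MO.
    exists i; rewrite inE wi /=; first exact/asboolP.
    by apply/asboolP; rewrite divff //; apply: unit_notM.
  by rewrite ltnNge; have /= -> := maxi j wj.
have : unitO (1 + \sum_(j | j != i) w j / w i).
  apply: unitDM => //; elim/big_ind: _ => [||j ji]; [|exact: MD|].
    by split; [exact: ring_set0|left].
  by have [->|wj] := eqVneq (w j) 0; [rewrite mul0r; split; [exact: ring_set0|left] | exact: dom].
case=> + _ _; apply: contra => /eqP; rewrite (bigD1 i) //= => s0.
by rewrite -[1](divff wi) -mulr_suml -mulrDl s0 mul0r.
Qed.

Variables (t : F) (N : nat).
Hypotheses (Mt : M t) (t0 : t != 0) (degt : deg_le iota t N).

(** Once the power of X is removed, the constant term is nonzero; as t lies in M, the value at t is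
    a nonzero constant plus an element of M, hence a unit. *)
Lemma peval_unit p : p != 0 -> exists k u, unitO u /\ peval t p = t ^+ k * u.
Proof.
move=> p0; have [k [q]] := multiplicity_XsubC p 0; rewrite p0 /= => q0 ->.
exists k, (peval t q); split; last first.
  by rewrite rmorphM rmorphXn /= pevalXsubC rmorph0 subr0 mulrC.
rewrite {1}(poly_split q) rmorphD rmorphM /= pevalC pevalX; apply: unitDM.
  by apply: unitK; move: q0; rewrite /root horner_coef0.
by rewrite mulrC; apply: MZ => //; apply: valuation_ring_peval; apply: MO.
Qed.

Lemma indep_dominated (I : finType) (y : I -> F) : (forall i, y i != 0) ->
  (forall i j k k', i != j ->
     M (t ^+ k * y i / (t ^+ k' * y j)) \/ M (t ^+ k' * y j / (t ^+ k * y i))) ->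
  indep iota t y.
Proof.
move=> y0 cmp phi sum0 i; apply/eqP; rewrite -[_ == _]negbK; apply/negP => phi0.
have wi : peval t (phi i) * y i != 0.
  have [k [u [[u0 _ _] ->]]] := peval_unit phi0.
  by rewrite !mulf_neq0 // expf_neq0.
have := dominated_sum (w := fun i => peval t (phi i) * y i) wi _.
rewrite sum0 eqxx => /(_ _)/negP; apply=> // {wi phi0}{}i j ij.
rewrite !mulf_eq0 !negb_or => /andP[pi _] /andP[pj _].
have {}pi : phi i != 0 by apply: contraNneq pi => ->; rewrite rmorph0.
have {}pj : phi j != 0 by apply: contraNneq pj => ->; rewrite rmorph0.
have [k [u [uu ->]]] := peval_unit pi; have [k' [v [uv ->]]] := peval_unit pj.
have e : forall (a b c d : F), a * u * b / (c * v * d) = (u / v) * (a * b / (c * d)).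
  by move=> a b c d; rewrite !invfM; ring.
have e' : forall (a b c d : F), a * v * b / (c * u * d) = (v / u) * (a * b / (c * d)).
  by move=> a b c d; rewrite !invfM; ring.
rewrite e e'; have [uv1 vu1] : unitO (u / v) /\ unitO (v / u).
  by split; apply: unitM => //; apply: unitV.
by have [Mc|Mc] := cmp i j k k' ij; [left|right]; apply: MZ => //; [case: uv1|case: vu1].
Qed.

Let chain n : Prop := exists x : nat -> F,
  [/\ x 0%N = t, forall i, (i <= n)%N -> M (x i) /\ x i != 0
    & forall i, (i < n)%N -> M (x i / x i.+1)].

Let chain_bound n : chain n -> (n < N)%N.
Proof.
move=> [x [x0 Mx sx]]; apply: (degt (z := fun i : 'I_n.+1 => x i)).
have ltx j i : (i < j)%N -> (j <= n)%N -> M (x i / x j).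
  elim: j => // j IH; rewrite ltnS leq_eqVlt => /orP[/eqP->|ij] jn; first exact: sx.
  have -> : x i / x j.+1 = (x i / x j) * (x j / x j.+1).
    by rewrite mulrA divfK //; case: (Mx j); rewrite // ltnW.
  by apply: MZ; [apply: MO; apply: IH => //; apply: ltnW|apply: sx].
have tx i : (i <= n)%N -> O (t / x i).
  case: i => [|i] le_in; first by rewrite x0 divff //; case: unit1.
  by rewrite -x0; apply: MO; apply: ltx.
have cmp (i j : 'I_n.+1) k k' : (i < j)%N ->
     M (t ^+ k * x i / (t ^+ k' * x j)) \/ M (t ^+ k' * x j / (t ^+ k * x i)).
  move=> ij; have [Mi xi] := Mx i (leq_ord i); have [Mj xj] := Mx j (leq_ord j).
  have [le_k|lt_k] := leqP k' k.
    left; have -> : t ^+ k * x i / (t ^+ k' * x j) = t ^+ (k - k') * (x i / x j).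
      by rewrite expfB_cond ?(negPf t0) // invfM; ring.
    by apply: MZ; [apply: OX; apply: MO|apply: ltx => //; apply: leq_ord].
  (* Here k < k', and one spare factor t absorbs the denominator x_i. *)
  right; have -> : t ^+ k' * x j / (t ^+ k * x i) = t ^+ (k' - k).-1 * (t / x i) * x j.
    have {1}-> : k' = ((k' - k).-1.+1 + k)%N by lia.
    by rewrite exprD exprS; field; rewrite xi expf_neq0.
  by apply: MZ => //; apply: OM; [apply: OX; apply: MO|apply: tx; apply: leq_ord].
apply: indep_dominated => [i|i j k k' ij]; first by case: (Mx i); rewrite ?leq_ord.
have := ij; rewrite -val_eqE neq_ltn => /orP[lt|lt]; first exact: cmp.
by have [c|c] := cmp j i k' k lt; [right|left].
Qed.

Let uniformizer_exists : exists T, [/\ M T, T != 0 & forall z, M z -> O (z / T)].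
Proof.
have ex0 : exists n, `[< chain n >].
  by exists 0%N; apply/asboolP; exists (fun=> t).
have bnd n : `[< chain n >] -> (n <= N)%N by move/asboolP/chain_bound/ltnW.
case: (ex_maxnP ex0 bnd) => n /asboolP[x [x0 Mx sx]] maxn.
have [Mn xn] := Mx n (leqnn n); exists (x n); split=> // z Mz.
apply: contrapT => nO; have := notO_M nO; rewrite invf_div => Mxz.
have z0 : z != 0 by apply: contra_notN nO => /eqP->; rewrite mul0r; apply: ring_set0.
suff /asboolP/maxn : chain n.+1 by rewrite ltnn.
exists (fun i => if (i <= n)%N then x i else z); split=> [|i|i].
- by [].
- by case: ifP => [/Mx //|_ _].
- rewrite ltnS => le_in; rewrite le_in; case: ifP => [|lt]; first exact: sx.
  have -> // : i = n.
  by apply/eqP; rewrite eqn_leq le_in leqNgt lt.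
Qed.

(* A chain of strict divisibilities starting at t is independent over K[t], so
   its length is bounded; the last member of a longest one is a uniformizer. *)
Lemma discrete_place :
  exists P : place iota, (forall z, O z -> vge P z 0) /\ (forall z, M z -> z != 0 -> 0 < P z).
Proof.
have [T [MT T0 genT]] := uniformizer_exists.
have TX n : T ^+ n != 0 by rewrite expf_neq0.
have unitTX z k : z != 0 -> O (z / T ^+ k) -> ~ O (z / T ^+ k.+1) -> unitO (z / T ^+ k).
  move=> z0 Ok nOk; have [/genT|//] := unit_or Ok.
  by rewrite -mulrA -invfM -exprSr => /nOk.
have bounded z k : z != 0 -> O z -> ~ O (z / T ^+ k) -> exists n, unitO (z / T ^+ n).
  move=> z0 Oz nOk.
  have ex0 : exists n, ~~ `[< O (z / T ^+ n) >] by exists k; apply/asboolPn.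
  case: (ex_minnP ex0) => [[|n]] /asboolPn nO minn.
    by move: nO; rewrite expr0 divr1.
  exists n; apply: unitTX => //; apply/asboolP; rewrite -[asbool _]negbK; apply/negP => /minn.
  by rewrite ltnn.
(* If T^(N+1) divided t, then t, T^N, ..., T would be a chain of the forbidden length N. *)
have [e ue] : exists e, unitO (t / T ^+ e).
  have Ot := MO Mt.
  apply: (bounded t N.+1 t0 Ot) => OtT.
  suff /chain_bound : chain N by rewrite ltnn.
  exists (fun i => if (i == 0)%N then t else T ^+ (N.+1 - i)); split=> // [i|i] le_iN.
    case: eqP => // _; split=> //; rewrite subSn // exprSr; apply: MZ => //.
    by apply: OX; apply: MO.
  case: (eqVneq i 0%N) => [->|i0] /=.
    have -> : t / T ^+ (N.+1 - 1) = t / T ^+ N.+1 * T.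
      by rewrite subn1 /= exprSr invfM -!mulrA mulVf // mulr1.
    by apply: MZ.
  rewrite subSn 1?ltnW // exprS subSS mulfK //.
(* An element divisible by all powers of T would be divisible by all powers of t, and its powers 1,
   z, ..., z^N would be independent over K[t]. *)
have exk z : z != 0 -> O z -> exists n, unitO (z / T ^+ n).
  move=> z0 Oz; apply: contrapT => noN.
  have OT k : O (z / T ^+ k) by apply: contrapT => /(bounded _ _ z0 Oz).
  have Mtk k : M (z / t ^+ k).
    have -> : z / t ^+ k = (t / T ^+ e) ^- k * (z / T ^+ (e * k).+1) * T.
      rewrite expr_div_n -exprM exprSr; field.
      by rewrite T0 TX expf_neq0.
    apply: MZ => //; apply: OM => //; rewrite -exprVn; apply: OX; by case: ue.
  have zX k n : M (z ^+ n.+1 / t ^+ k).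
    by rewrite exprSr -mulrA; apply: MZ => //; apply: OX.
  have : indep iota t (fun i : 'I_N.+1 => z ^+ i).
    apply: indep_dominated => [i|i j k k']; first exact: expf_neq0.
    have cmp (a b : 'I_N.+1) k1 k2 : (a < b)%N -> M (t ^+ k2 * z ^+ b / (t ^+ k1 * z ^+ a)).
      move=> ab; have -> : t ^+ k2 * z ^+ b / (t ^+ k1 * z ^+ a) = t ^+ k2 * (z ^+ (b - a) / t
        ^+ k1).
        by rewrite expfB_cond ?(negPf z0) 1?ltnW // invfM; ring.
      apply: MZ; first by apply: OX; apply: MO.
      by rewrite -[(b - a)%N]prednK ?subn_gt0.
    rewrite -val_eqE neq_ltn => /orP[lt|lt]; [right|left]; exact: cmp.
  by move/degt; rewrite ltnn.
have /choice[v vP] z : exists k : int, z != 0 -> unitO (z / T ^ k).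
  have [z0|z0] := eqVneq z 0; first by exists 0.
  have [Oz|Oz] := valO z.
    by have [n un] := exk z z0 Oz; exists n%:Z.
  have [n un] := exk z^-1 (invr_neq0 z0) Oz; exists (- n%:Z) => _.
  have -> : z / T ^ (- n%:Z) = (z^-1 / T ^+ n)^-1 by rewrite invf_div -invr_expz !invrK mulrC.
  exact: unitV.
have TZ k : T ^ k != 0 by apply: expfz_neq0.
have unitT k : unitO (T ^ k) -> k = 0.
  have pos n : ~ unitO (T ^+ n.+1).
    by move/unit_notM; apply; rewrite exprSr; apply: MZ => //; apply: OX; apply: MO.
  case: k => [[|n]|n] // => [/pos //|/unitV]; rewrite NegzE -invr_expz invrK => /pos //.
have v_uniq z k : z != 0 -> unitO (z / T ^ k) -> v z = k.
  move=> z0 uk; apply/eqP; rewrite -subr_eq0; apply/eqP/unitT.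
  have -> : T ^ (v z - k) = (z / T ^ k) / (z / T ^ v z).
    by rewrite expfzDr // -invr_expz; field; rewrite z0 !TZ.
  by apply: unitM => //; apply/unitV/vP.
have v_ge0 z : z != 0 -> O z -> 0 <= v z.
  by move=> z0 Oz; have [n un] := exk z z0 Oz; rewrite (v_uniq z n%:Z).
have v_M z : z != 0 -> M z -> 0 < v z.
  move=> z0 Mz; rewrite lt_def (v_ge0 z z0 (MO Mz)) andbT; apply/eqP => v0.
  by have := vP z z0; rewrite v0 expr0z divr1 => /unit_notM.
have O_ge0 z : z != 0 -> 0 <= v z -> O z.
  move=> z0 vz; have [_ Oz _] := vP z z0; rewrite -[z](divfK (TZ (v z))); apply: OM => //.
  by case: (v z) vz => // n _; apply: OX; apply: MO.
have vM z w : z != 0 -> w != 0 -> v (z * w) = v z + v w.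
  move=> z0 w0; apply: v_uniq; first exact: mulf_neq0.
  have -> : z * w / T ^ (v z + v w) = (z / T ^ v z) * (w / T ^ v w).
    by rewrite expfzDr // invfM; ring.
  by apply: unitM; apply: vP.
have vV z : z != 0 -> v z^-1 = - v z.
  move=> z0; apply: v_uniq; first by rewrite invr_eq0.
  have -> : z^-1 / T ^ (- v z) = (z / T ^ v z)^-1 by rewrite -invr_expz invf_div invrK mulrC.
  exact/unitV/vP.
have vD z w : z != 0 -> w != 0 -> z + w != 0 -> Num.min (v z) (v w) <= v (z + w).
  wlog le : z w / v z <= v w => [wl|] z0 w0 zw0.
    have /orP[le|le] := le_total (v z) (v w); first exact: wl.
    by rewrite minC addrC; apply: wl => //; rewrite addrC.
  rewrite min_l //; have e1 : z + w = z * (1 + w / z) by rewrite mulrDr mulr1 mulrCA divff ?mulr1.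
  have e0 : 1 + w / z != 0 by apply: contraNneq zw0 => e0; rewrite e1 e0 mulr0.
  rewrite e1 vM // lerDl v_ge0 //; apply: ring_setD => //; first by case: rO.
  by apply: O_ge0; rewrite ?mulf_neq0 ?invr_eq0 // vM ?invr_eq0 // vV // subr_ge0.
(* Choice leaves [v 0] arbitrary, while [place] requires the value 0 there. *)
pose v' z := if z == 0 then 0 else v z.
have v'E z : z != 0 -> v' z = v z by rewrite /v' => /negPf->.
have v'0 : v' 0 = 0 by rewrite /v' eqxx.
have v'M z w : z != 0 -> w != 0 -> v' (z * w) = v' z + v' w.
  by move=> z0 w0; rewrite !v'E ?mulf_neq0 // vM.
have v'D z w : z != 0 -> w != 0 -> z + w != 0 -> Num.min (v' z) (v' w) <= v' (z + w).
  by move=> z0 w0 zw0; rewrite !v'E // vD.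
have v'K c : c != 0 -> v' (iota c) = 0.
  move=> c0; rewrite v'E ?fmorph_eq0 //; apply: v_uniq; rewrite ?fmorph_eq0 //.
  by rewrite expr0z divr1; apply: unitK.
have v'1 : exists2 s : F, s != 0 & v' s = 1.
  by exists T => //; rewrite v'E //; apply: v_uniq => //; rewrite expr1z divff.
exists (Place v'0 v'M v'D v'K v'1); split=> z /= => [Oz z0|Mz z0]; rewrite /= v'E //.
  exact: v_ge0.
exact: v_M.
Qed.

End DiscretePlace.

(** * Degrees of places and of polar divisors *)

Section Approximation.
Variables (K F : fieldType) (iota : {rmorphism K -> F}).
Implicit Types (P Q : place iota) (s : seq (place iota)).
Local Notation peval := (peval iota).

Lemma val_expz P z (n : int) : P (z ^ n) = n * P z.
Proof.
case: n => n; first by rewrite -exprnP val_exp -mulr_natl natz.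
by rewrite NegzE -invr_expz val_inv -exprnP val_exp -mulr_natl natz mulNr.
Qed.

Lemma uniformizer P : {T | T != 0 & P T = 1}.
Proof. by apply: cid2; have [T T0 PT] := val_at1 P; exists T. Qed.

(** Elements with v_P = 0 also have v_Q = 0, so v_Q = v_Q(T) v_P for a uniformizer T of P. Since v_Q
    takes the value 1 and v_Q(T) >= 0, the factor v_Q(T) is 1. *)
Lemma place_sub_eq P Q : (forall z, vge P z 0 -> vge Q z 0) -> P = Q.
Proof.
move=> sub; have [T T0 PT] := uniformizer P; have [S S0 QS] := uniformizer Q.
have unit_eq z : z != 0 -> P z = 0 -> Q z = 0.
  move=> z0 Pz; apply/eqP; rewrite eq_le; apply/andP; split; last first.
    by apply: sub z0 => _; rewrite Pz.
  rewrite -oppr_ge0 -val_inv; apply: sub; rewrite ?invr_eq0 // => _.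
  by rewrite val_inv Pz oppr0.
have QP z : z != 0 -> Q z = P z * Q T.
  move=> z0; have TZ : T ^ P z != 0 by apply: expfz_neq0.
  have := unit_eq (z / T ^ P z);
    rewrite mulf_neq0 ?invr_eq0 // !val_div // !val_expz PT mulr1 subrr.
  by move/(_ isT erefl)/eqP; rewrite subr_eq0 => /eqP.
have QT0 : 0 <= Q T by apply: sub T0 => _; rewrite PT.
have := QP S S0; rewrite QS => e; have QT1 : Q T = 1.
  have [PS|PS] : P S <= 0 \/ 1 <= P S; [lia|nia|nia].
apply: place_eq => z; have [->|z0] := eqVneq z 0; first by rewrite !val_at0.
by rewrite QP // QT1 mulr1.
Qed.

Lemma separate_two P Q : P <> Q -> exists u, [/\ u != 0, 0 < P u & Q u < 0].
Proof.
have half P1 Q1 : P1 <> Q1 -> exists u, [/\ u != 0, 0 <= P1 u & Q1 u < 0].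
  move=> PQ; apply: contrapT => no; apply: PQ; apply: place_sub_eq => z Pz z0.
  by rewrite leNgt; apply/negP => Qz; apply: no; exists z; split=> //; apply: Pz.
move=> PQ; have [a [a0 Pa Qa]] := half P Q PQ.
have [b [b0 Qb Pb]] := half Q P (nesym PQ).
exists (a / b); rewrite mulf_neq0 ?invr_eq0 // !val_div //; split=> //; lia.
Qed.

Lemma separate P s : P \notin s ->
  exists u, [/\ u != 0, 0 < P u & forall Q, Q \in s -> Q u < 0].
Proof.
elim: s => [_|Q s IH]; first by have [T T0 PT] := uniformizer P; exists T; rewrite PT.
rewrite inE negb_or => /andP[/eqP PQ /IH[y [y0 Py sy]]].
have [Qy|Qy] := ltP (Q y) 0.
  by exists y; split=> // R; rewrite inE => /orP[/eqP->|/sy].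
have [z [z0 Pz Qz]] := separate_two PQ.
(* As r exceeds every |v_R(y)|, the value of y + z^r is decided by z^r at the poles of z in s and by
   y at the remaining places of s; it is negative in both cases. *)
pose r := (\max_(R <- s) `|R y|%N).+1.
have lt_r R : R \in s -> (`|R y| < r)%N.
  by move=> Rs; rewrite ltnS; apply: leq_bigmax_seq.
have zr0 : z ^+ r != 0 by rewrite expf_neq0.
have Qlt : Q (z ^+ r) < Q y by rewrite val_exp; nia.
have [|yz0 Qyz] := @val_add_lt _ _ _ Q (z ^+ r) y zr0; first by move=> _; lia.
exists (y + z ^+ r); rewrite addrC; split=> // [|R].
  have /(_ yz0) // : vge P (z ^+ r + y) 1.
  by apply: vgeD => _ //; rewrite val_exp; nia.
rewrite inE => /orP[/eqP->|Rs]; first by rewrite Qyz val_exp; nia.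
have Ry := sy R Rs; have ltR := lt_r R Rs.
have [lt|le] := ltP (R (z ^+ r)) (R y).
  by have [|_ ->] := @val_add_lt _ _ _ R (z ^+ r) y zr0; [move=> _; lia | lia].
rewrite addrC; have [|_ -> //] := @val_add_lt _ _ _ R y (z ^+ r) y0.
move=> _; move: le; rewrite val_exp.
have [Rz|Rz] : 0 <= R z \/ R z <= -1; [lia|nia|nia].
Qed.

Lemma weak_approximation P s (N : nat) : P \notin s ->
  exists w, vge P (w - 1) N%:Z /\ forall Q, Q \in s -> vge Q w N%:Z.
Proof.
move=> /separate[u [u0 Pu su]]; have uN : u ^+ N.+1 != 0 by rewrite expf_neq0.
have [|e0 Pe] := @val_add_lt _ _ _ P 1 (u ^+ N.+1) (oner_neq0 _).
  by move=> _; rewrite val_one val_exp; nia.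
(* This element is near 1 at the zeros of u and near 0 at its poles. *)
exists (1 + u ^+ N.+1)^-1; split=> [|Q Qs].
  have -> : (1 + u ^+ N.+1)^-1 - 1 = - (u ^+ N.+1 / (1 + u ^+ N.+1)) by field.
  by apply: vgeN => _; rewrite val_div // Pe val_one val_exp; nia.
have Qu := su Q Qs.
have [|_ Qe] := @val_add_lt _ _ _ Q (u ^+ N.+1) 1 uN.
  by move=> _; rewrite val_one val_exp; nia.
by move=> _; rewrite val_inv addrC Qe val_exp; nia.
Qed.

Lemma valuation_ringE P : valuation_ring P = [set z | vge P z 0].
Proof.
apply/seteqP; split=> z /=; first by case=> [->|Pz _] //; apply: vge0.
by move=> Pz; have [->|z0] := eqVneq z 0; [left|right; apply: Pz].
Qed.

Lemma maximal_idealE P : maximal_ideal P = [set z | vge P z 1].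
Proof.
apply/seteqP; split=> z /=; first by case=> [->|Pz _] //; apply: vge0.
by move=> Pz; have [->|z0] := eqVneq z 0; [left|right; apply: Pz].
Qed.

Definition box s (a : place iota -> int) : set F :=
  [set z | forall P, P \in s -> vge P z (a P)].

Lemma subspace_box s a : subspace iota (box s a).
Proof.
split=> [P _|z w zs ws P Ps|c z zs P Ps]; first exact: vge0.
  by apply: vgeD; [apply: zs|apply: ws].
by apply: vgeZ; apply: zs.
Qed.

(** A family free in the residue field at P is moved to order a(P) by a power of a uniformizer, then
    multiplied by some w near 1 at P and near 0 at the other places of s, so that only P matters. *)
Lemma box_step s a P d : uniq s -> P \in s ->
  dim_ge iota (valuation_ring P) (maximal_ideal P) d ->
  dim_ge iota (box s a) (box s (fun Q => a Q + (Q == P)%:Z)) d.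
Proof.
rewrite valuation_ringE maximal_idealE => us Ps [e [Oe fe]].
have [T T0 PT] := uniformizer P; have TP : T ^ a P != 0 by apply: expfz_neq0.
pose f j := e j * T ^ a P.
pose s' := rem P s; have Ps' : P \notin s' by rewrite mem_rem_uniq // inE eqxx.
pose N := (\max_(Q <- s') \max_(j < d) `|a Q - Q (f j)|%N).+1.
have [w [Pw sw]] := weak_approximation N Ps'.
have w0 : w != 0.
  apply/negP => /eqP w0; move: Pw; rewrite w0 sub0r /vge oppr_eq0 oner_neq0 val_opp val_one.
  by move/(_ isT).
have Pw0 : P w = 0.
  have -> : w = 1 + (w - 1) by rewrite addrC subrK.
  have [|_ ->] := @val_add_lt _ _ _ P 1 (w - 1) (oner_neq0 _); last exact: val_one.
  by rewrite val_one; apply: vgeW Pw.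
exists (fun j => f j * w); split=> [j Q Qs|c Wc].
  have [->|QP] := eqVneq Q P.
    rewrite -[a P]add0r -[0 + a P]addr0; apply: vgeM; last by move=> _; rewrite Pw0.
    by apply: vgeM; [apply: Oe|move=> _; rewrite val_expz PT mulr1].
  have Qs' : Q \in s' by rewrite mem_rem_uniq // inE QP.
  apply: (@vgeW _ _ _ _ _ (Q (f j) + N%:Z)); last by apply: vgeM; [apply: vge_refl|apply: sw].
  have le1 : (`|a Q - Q (f j)| <= \max_(j < d) `|a Q - Q (f j)|)%N.
    exact: (leq_bigmax j).
  have le2 : (\max_(j < d) `|a Q - Q (f j)| < N)%N.
    rewrite ltnS.
    exact: (@leq_bigmax_seq _ s' xpredT (fun Q : place iota => \max_(j < d) `|a Q - Q (f j)|)%N Q).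
  lia.
apply: fe => /= s0.
have := Wc P Ps; rewrite eqxx.
have -> : \sum_i iota (c i) * (f i * w) = (\sum_i iota (c i) * e i) * T ^ a P * w.
  by rewrite !mulr_suml; apply: eq_bigr => i _; rewrite /f !mulrA.
move=> /(_ _); rewrite !mulf_neq0 // => /(_ isT).
by rewrite !val_atM ?mulf_neq0 // Pw0 val_expz PT mulr1 addr0 addrC lerD2r.
Qed.

Lemma box_raise s a P d k : uniq s -> P \in s ->
  dim_ge iota (valuation_ring P) (maximal_ideal P) d ->
  dim_ge iota (box s a) (box s (fun Q => a Q + ((Q == P) * k)%N%:Z)) (k * d).
Proof.
move=> us Ps ged; elim: k => [|k IH].
  by exists (fun=> 0); split=> [[]|c _ []].
rewrite mulSnr; apply: (dim_ge_trans _ _ (subspace_box _ _) IH).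
- by move=> z zs Q Qs; apply: vgeW (zs Q Qs); rewrite lerDl.
- by move=> z zs Q Qs; apply: vgeW (zs Q Qs); rewrite lerD2l; case: (Q == P); lia.
have := box_step (fun Q => a Q + ((Q == P) * k)%N%:Z) us Ps ged.
congr (dim_ge _ _ (box s _) _); apply/funext => Q; case: (Q == P); lia.
Qed.

Lemma box_total s r (b d : place iota -> nat) : uniq s -> uniq r -> {subset r <= s} ->
  (forall P, P \in s -> dim_ge iota (valuation_ring P) (maximal_ideal P) (d P)) ->
  dim_ge iota (box s (fun=> 0)) (box s (fun P => if P \in r then (b P)%:Z else 0))
    (\sum_(P <- r) b P * d P).
Proof.
move=> us + + ged; elim: r => [_ _|P r IH /= /andP[Pr ur] rs].
  by rewrite big_nil; exists (fun=> 0); split=> [[]|c _ []].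
have Ps : P \in s by apply: rs; rewrite inE eqxx.
rewrite big_cons addnC.
have rs' : {subset r <= s} by move=> Q Qr; apply: rs; rewrite inE Qr orbT.
apply: (dim_ge_trans _ _ (subspace_box _ _) (IH ur rs')).
- by move=> z zs Q Qs; apply: vgeW (zs Q Qs); case: ifP.
- move=> z zs Q Qs; apply: vgeW (zs Q Qs); rewrite inE; case: ifP => Qr; first by rewrite orbT.
  by case: ifP.
have := box_raise (fun Q => if Q \in r then (b Q)%:Z else 0) (b P) us Ps (ged P Ps).
congr (dim_ge _ _ (box s _) _); apply/funext => Q; rewrite inE.
by have [->|_] := eqVneq Q P; rewrite ?(negPf Pr) /=; lia.
Qed.

Lemma vge_peval P t p : vge P t 0 -> vge P (peval t p) 0.
Proof.
move=> Pt; rewrite peval_sum; apply: vge_sum => i _; apply: vgeZ; exact: vgeX.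
Qed.

(** Modulo t a relation only sees the constant terms of its coefficients, which therefore vanish;
    the relation can then be divided by t, and induction on the index of the coefficient removes the
    rest. *)
Lemma box_indep s t (I : finType) (e : I -> F) : t != 0 ->
  (forall P, P \in s -> 0 < P t) ->
  free_family iota (box s (fun=> 0)) (box s (fun P => P t)) e -> indep iota t e.
Proof.
move=> t0 st [Oe fe].
have const0 (phi : I -> {poly K}) : \sum_i peval t (phi i) * e i = 0 -> forall i, (phi i)`_0 = 0.
  move=> phi0.
  have psiB : \sum_i iota (phi i)`_0 * e i = - (t * \sum_i peval t (drop_poly 1 (phi i)) * e i).
    apply/eqP; rewrite -addr_eq0 mulr_sumr -big_split /= -[X in _ == X]phi0; apply/eqP.
    apply: eq_bigr => i _; rewrite [in RHS](poly_split (phi i)) rmorphD rmorphM /= pevalC pevalX.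
    by rewrite mulrDl mulrA.
  apply: (fe (fun i => (phi i)`_0)) => P Ps; rewrite psiB; apply: vgeN.
  rewrite -[P t]addr0; apply: vgeM; first exact: vge_refl.
  apply: vge_sum => i _; rewrite -[0]addr0; apply: vgeM; last exact: Oe.
  by apply: vge_peval => _; apply/ltW/st.
move=> phi phi0 i; apply/polyP => k; rewrite coef0; move: i.
elim: k phi phi0 => [|k IH] phi phi0; first exact: const0.
move=> i; have := IH (fun i => drop_poly 1 (phi i)) _ i; rewrite coef_drop_poly addn1; apply.
apply: (mulfI t0); rewrite mulr0 mulr_sumr -[RHS]phi0; apply: eq_bigr => j _.
by rewrite [in RHS](poly_split (phi j)) const0 // polyC0 add0r rmorphM /= pevalX mulrA.
Qed.

(** The inequality sum e_P f_P <= [F : K(t)]. Here d(P) is only a lower bound for the dimension of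
    the residue field, because it is this inequality that will show residue degrees to be finite. *)
Lemma fundamental_inequality s t N (d : place iota -> nat) : uniq s -> t != 0 ->
  deg_le iota t N -> (forall P, P \in s -> 0 < P t) ->
  (forall P, P \in s -> dim_ge iota (valuation_ring P) (maximal_ideal P) (d P)) ->
  (\sum_(P <- s) `|P t|%N * d P <= N)%N.
Proof.
move=> us t0 degt st ged.
have [] := @box_total s s (fun P => `|P t|%N) d us us _ ged; first by [].
move=> e [Oe fe]; apply: (degt _ e); apply: (box_indep t0 st); split=> // c Wc.
apply: fe => P Ps; have := Wc P Ps; rewrite Ps gez0_abs //; exact/ltW/st.
Qed.

Section Degree.
Variables (t : F) (N : nat).
Hypotheses (t0 : t != 0) (degt : deg_le iota t N).

Lemma place_degree_basis P : 0 < P t ->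
  exists e : 'I_(place_degree P) -> F,
    quotient_basis iota (valuation_ring P) (maximal_ideal P) e.
Proof.
move=> Pt; apply: (@quotient_dimP _ _ _ _ _ N).
- rewrite valuation_ringE; exact: vge_subspace.
- rewrite maximal_idealE; exact: vge_subspace.
move=> n gen.
have : (\sum_(Q <- [:: P]) `|Q t|%N * n <= N)%N.
  by apply: (@fundamental_inequality _ t N (fun=> n)) => // Q; rewrite inE => /eqP->.
by rewrite big_seq1; apply: leq_trans; rewrite leq_pmull // absz_gt0 gt_eqF.
Qed.

Lemma place_degree_dim_ge P : 0 < P t ->
  dim_ge iota (valuation_ring P) (maximal_ideal P) (place_degree P).
Proof.
case/place_degree_basis => e; apply: quotient_basis_dim_ge; first by left.
rewrite maximal_idealE; exact: vge_subspace.
Qed.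

Lemma place_degree_dim_le P : 0 < P t ->
  dim_le iota (valuation_ring P) (maximal_ideal P) (place_degree P).
Proof. by case/place_degree_basis => e; apply: quotient_basis_dim_le. Qed.

Lemma place_degree_gt0 P : 0 < P t -> (0 < place_degree P)%N.
Proof.
move=> Pt; apply: (@dim_ge_le _ _ iota (valuation_ring P) (maximal_ideal P)).
- rewrite maximal_idealE; exact: vge_subspace.
- exists (fun=> 1); rewrite valuation_ringE maximal_idealE; split=> [i _|c].
    by rewrite val_one.
  rewrite big_ord1 mulr1 /= => c1 i; rewrite [i]ord1; apply/eqP; rewrite -[_ == _]negbK;
    apply/negP => c0.
  by have := c1; rewrite /vge fmorph_eq0 val_atK // => /(_ c0).
- exact: place_degree_dim_le.
Qed.

Lemma zeros_bound s : uniq s -> (forall P, P \in s -> 0 < P t) ->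
  (\sum_(P <- s) `|P t|%N * place_degree P <= N)%N.
Proof.
move=> us st; apply: fundamental_inequality => // P /st; exact: place_degree_dim_ge.
Qed.

Lemma zeros_finite : exists2 s, uniq s & forall P, (P \in s) = (0 < P t).
Proof.
pose S n := exists s, [/\ size s = n, uniq s & forall P, P \in s -> 0 < P t].
have ex0 : exists n, `[< S n >] by exists 0%N; apply/asboolP; exists [::].
have bnd n : `[< S n >] -> (n <= N)%N.
  move=> /asboolP[s [<- us st]]; apply: leq_trans (zeros_bound us st).
  rewrite -sum1_size big_seq [X in (_ <= X)%N]big_seq; apply: leq_sum => P /st Pt.
  by rewrite muln_gt0 place_degree_gt0 // andbT absz_gt0 gt_eqF.
case: (ex_maxnP ex0 bnd) => n /asboolP[s [sn us st]] maxn.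
exists s => // P; apply/idP/idP => [/st //|Pt]; rewrite -[_ \in _]negbK; apply/negP => Ps.
suff /asboolP/maxn : S n.+1 by rewrite ltnn.
exists (P :: s); rewrite /= sn us Ps; split=> // Q; rewrite inE => /orP[/eqP->|/st] //.
Qed.

Lemma divisor_degree_seq s (A : place iota -> int) : uniq s ->
  (forall P, P \notin s -> A P = 0) ->
  divisor_degree A = \sum_(P <- s) A P * (place_degree P)%:Z.
Proof.
move=> us sA; rewrite /divisor_degree (fsbigE s) //; last by move=> P _ /sA->; rewrite mul0r.
by apply: eq_bigl => P; rewrite in_setT.
Qed.

Lemma is_divisor_seq s (A : place iota -> int) :
  (forall P, P \notin s -> A P = 0) -> is_divisor A.
Proof.
move=> sA; apply: (@sub_finite_set _ _ [set` s]); last exact: finite_seq.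
by move=> P /=; apply: contraNT => /sA->.
Qed.

Lemma pole_divisorV P : pole_divisor t^-1 P = Num.max 0 (P t).
Proof. by rewrite /pole_divisor val_inv opprK. Qed.

Lemma pole_divisorV_degree s : uniq s -> (forall P, (P \in s) = (0 < P t)) ->
  divisor_degree (pole_divisor (iota := iota) t^-1) = (\sum_(P <- s) `|P t|%N * place_degree
    P)%N%:Z.
Proof.
move=> us st; rewrite (divisor_degree_seq us) => [|P]; last first.
  by rewrite st pole_divisorV -leNgt => /max_l.
rewrite -[RHS]natz natr_sum; apply: eq_big_seq => P; rewrite st pole_divisorV => Pt.
by rewrite max_r ?ltW // natz PoszM gez0_abs // ltW.
Qed.

Lemma pole_divisorV_is_divisor : is_divisor (pole_divisor (iota := iota) t^-1).
Proof.
have [s us st] := zeros_finite; apply: (@is_divisor_seq s) => P.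
by rewrite st pole_divisorV -leNgt => /max_l.
Qed.

Lemma pole_divisorV_degree_le :
  divisor_degree (pole_divisor (iota := iota) t^-1) <= N%:Z.
Proof.
have [s us st] := zeros_finite; rewrite (pole_divisorV_degree us st) lez_nat.
by apply: zeros_bound => // P; rewrite st.
Qed.

(** Each of the N distinct zeros contributes at least 1, which already exhausts the upper bound
    N. *)
Lemma pole_divisorV_degree_eq s : uniq s -> size s = N -> (forall P, P \in s -> 0 < P t) ->
  divisor_degree (pole_divisor (iota := iota) t^-1) = N%:Z.
Proof.
move=> us sN sP; apply/eqP; rewrite eq_le pole_divisorV_degree_le /=.
have [r ur rt] := zeros_finite; rewrite (pole_divisorV_degree ur rt) lez_nat -sN.
rewrite -sum1_size; apply: (@leq_trans (\sum_(P <- r) 1)).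
  rewrite !sum1_size; apply: uniq_leq_size => // P /sP; by rewrite rt.
rewrite big_seq [X in (_ <= X)%N]big_seq; apply: leq_sum => P; rewrite rt => Pt.
by rewrite muln_gt0 place_degree_gt0 // andbT absz_gt0 gt_eqF.
Qed.

End Degree.
End Approximation.

(** * Degrees over K(t) bounded by counting dimensions over K *)

Section Counting.
Variables (K F : fieldType) (iota : {rmorphism K -> F}).
Local Notation peval := (peval iota).

(* Compare dimensions over K: after multiplication by c (c2(tau))^M, the products
   t^k z_i with k < M fall in a space of dimension N (d M + B), B constant. *)
Lemma counting (I : finType) (z : I -> F) (tau : F) (N d : nat) (eps : 'I_N -> F) (c : F)
    (rho : I -> 'I_N -> {poly K}) (c1 c2 : {poly K}) :
  c != 0 -> (forall i, c * z i = \sum_j peval tau (rho i j) * eps j) ->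
  (size c1 <= d.+1)%N -> (size c2 <= d.+1)%N -> peval tau c2 != 0 ->
  indep iota (peval tau c1 / peval tau c2) z -> (#|I| <= N * d)%N.
Proof.
move=> c0 cz sc1 sc2 c20 indz; rewrite leqNgt; apply/negP => lt_I.
set t := peval tau c1 / peval tau c2 in indz.
pose B := (\max_i \max_j size (rho i j))%N.
have leB i j : (size (rho i j) <= B)%N.
  by apply: (leq_trans _ (leq_bigmax i)); apply: (leq_bigmax j).
(* M > N B makes the unknowns, at least (N d + 1) M in number, exceed the N (d M + B) equations. *)
pose M := (N * B).+1; pose W := (d * M + B)%N.
have size_exp (q : {poly K}) k : (size q <= d.+1)%N -> (size (q ^+ k) <= (d * k).+1)%N.
  move=> sq; apply: leq_trans (size_poly_exp_leq q k) _.
  by rewrite ltnS leq_mul2r; apply/orP; right; case: (size q) sq.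
pose g (i : I) (k : 'I_M) (j : 'I_N) : {poly K} := c1 ^+ k * c2 ^+ (M - k) * rho i j.
have sg i k j : (size (g i k j) <= W)%N.
  have le1 : (size (c1 ^+ k * c2 ^+ (M - k))%R <= (d * M).+1)%N.
    apply: leq_trans (size_polyMleq _ _) _.
    have := size_exp c1 k sc1; have := size_exp c2 (M - k)%N sc2; have := ltn_ord k.
    have -> : (d * M = d * k + d * (M - k))%N by rewrite -mulnDr subnKC // ltnW.
    lia.
  apply: leq_trans (size_polyMleq _ _) _; have := leB i j; rewrite /W; lia.
have [|a [[i0 k0] ai0] asum] := @homogeneous_solution K (I * 'I_M)%type ('I_N * 'I_W)%type
    (fun ik js => (g ik.1 ik.2 js.1)`_(js.2)).
  rewrite !card_prod !card_ord /W.
  have : ((N * d).+1 * M <= #|I| * M)%N by rewrite leq_mul2r lt_I orbT.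
  apply: leq_trans; rewrite mulSn mulnDr mulnA addnC ltn_add2r /M; lia.
have gsum j : \sum_(ik : I * 'I_M) (a ik) *: g ik.1 ik.2 j = 0.
  apply/polyP => s; rewrite coef0 coef_sum.
  have [lt|le] := ltnP s W; last first.
    by apply: big1 => ik _; rewrite coefZ nth_default ?mulr0 // (leq_trans (sg _ _ _)).
  by rewrite -[RHS](asum (j, Ordinal lt)); apply: eq_bigr => ik _; rewrite coefZ.
pose phi i : {poly K} := \sum_(k < M) a (i, k) *: 'X^k.
have phik i (k : 'I_M) : (phi i)`_k = a (i, k).
  rewrite /phi coef_sum (bigD1 k) //= coefZ coefXn eqxx mulr1 big1 ?addr0 // => k' k'k.
  by rewrite coefZ coefXn eq_sym -val_eqE in k'k *; rewrite (negPf k'k) mulr0.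
suff sum0 : \sum_i peval t (phi i) * z i = 0.
  by have := indz phi sum0 i0; move/(congr1 (fun q : {poly K} => q`_k0));
    rewrite phik coef0 => /eqP; rewrite (negPf ai0).
have CM : peval tau c2 ^+ M * c != 0 by rewrite mulf_neq0 ?expf_neq0.
apply: (mulfI CM); rewrite mulr0 mulr_sumr.
have -> : \sum_i peval tau c2 ^+ M * c * (peval t (phi i) * z i) =
    \sum_i \sum_(k < M) \sum_j (peval tau (a (i, k) *: g i k j)) * eps j.
  apply: eq_bigr => i _; rewrite mulrACA /phi rmorph_sum /= mulr_sumr mulr_suml.
  apply: eq_bigr => k _; rewrite cz mulr_sumr; apply: eq_bigr => j _.
  rewrite -!mul_polyC !rmorphM /= !rmorphXn /= !pevalC pevalX.
  have e : peval tau c2 ^+ M * t ^+ k = peval tau c1 ^+ k * peval tau c2 ^+ (M - k).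
    have le_k : (k <= M)%N by apply/ltnW.
    by rewrite -{1}(subnK le_k) exprD /t expr_div_n; field; rewrite expf_neq0.
  by rewrite [X in X * _]mulrCA e; ring.
rewrite pair_big /= exchange_big /= big1 // => j _.
rewrite -mulr_suml -rmorph_sum /= (eq_bigr (fun ik => a ik *: g ik.1 ik.2 j)); last by case.
by rewrite gsum rmorph0 mul0r.
Qed.

End Counting.

Lemma peval_map_polyC (K F : fieldType) (iota : {rmorphism K -> F}) (x y : F) (g : {poly K}) :
  peval (peval iota y) x (map_poly polyC g) = peval iota x g.
Proof.
rewrite /peval /= /horner_eval -map_poly_comp; congr (_.[x]).
by apply: eq_map_poly => c /=; rewrite /peval /= /horner_eval map_polyC hornerC.
Qed.

(** * Bivariate evaluation and places with a prescribed centre *)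

Section Bivariate.
Variables (K F : fieldType) (iota : {rmorphism K -> F}).
Local Notation biv x y := (peval (peval iota x) y).
Local Notation peval := (peval iota).

Lemma bivC x y c : biv x y c%:P = peval x c.
Proof. exact: pevalC. Qed.

Lemma biv_swap x y (G : {poly {poly K}}) : exists H : {poly {poly K}}, biv x y G = biv y x H.
Proof.
exists (\sum_(i < size G) map_poly polyC G`_i * ('X)%:P ^+ i).
rewrite (peval_widen _ _ (leqnn _)) rmorph_sum; apply: eq_bigr => i _.
by rewrite rmorphM rmorphXn /= peval_map_polyC bivC pevalX.
Qed.

Lemma biv_reduce x y (Psi G : {poly {poly K}}) : Psi != 0 -> biv x y Psi = 0 ->
  exists k (R : {poly {poly K}}), (size R < size Psi)%N /\ peval x (lead_coef Psi) ^+ k * biv x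
    y G = biv x y R.
Proof.
move=> Psi0 Psixy; have := Pdiv.Idomain.divp_eq G Psi.
exists (Pdiv.IdomainDefs.scalp G Psi), (Pdiv.IdomainDefs.modp G Psi).
split; first by rewrite Pdiv.Idomain.ltn_modp.
have := congr1 (biv x y) (Pdiv.Idomain.divp_eq G Psi).
by rewrite -mul_polyC rmorphM rmorphD rmorphM /= bivC rmorphXn /= Psixy mulr0 add0r.
Qed.

End Bivariate.
(** [red] factors through the image of [ev], and its kernel gives there a proper ideal to which
    Chevalley's theorem applies. The element [s], with its degree bound, makes the resulting
    valuation discrete. *)
Lemma place_center (K F : fieldType) (iota : {rmorphism K -> F}) (T : comNzRingType)
    (ev : {rmorphism T -> F}) (red : {rmorphism T -> K}) (N : nat) (s : T) :
  (forall c, exists G, ev G = iota c) -> (forall G, ev G = 0 -> red G = 0) ->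
  red s = 0 -> ev s != 0 -> deg_le iota (ev s) N ->
  exists P : place iota, (forall G, vge P (ev G) 0) /\
    (forall G, red G = 0 -> ev G != 0 -> 0 < P (ev G)).
Proof.
move=> evK ker reds evs degs.
pose R : set F := [set z | exists G, z = ev G].
pose I : set F := [set z | exists2 G, red G = 0 & z = ev G].
have rR : ring_set R.
  split; first by exists 1; rewrite rmorph1.
    by move=> _ _ [G ->] [H ->]; exists (G - H); rewrite rmorphB.
  by move=> _ _ [G ->] [H ->]; exists (G * H); rewrite rmorphM.
have iI : ideal_in R I.
  split; first by move=> _ [G _ ->]; exists G.
  - by exists 0; rewrite rmorph0.
  - by move=> _ _ [G rG ->] [H rH ->]; exists (G - H); rewrite rmorphB // rG rH subrr.
  by move=> _ _ [G ->] [H rH ->]; exists (G * H); rewrite rmorphM // rH mulr0.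
have nI1 : ~ I 1.
  case=> G rG e; have : ev (G - 1) = 0 by rewrite rmorphB rmorph1 -e subrr.
  by move/ker; rewrite rmorphB rmorph1 rG sub0r => /eqP; rewrite oppr_eq0 oner_eq0.
have [O [rO RO valO IO]] := chevalley rR iI nI1.
have KO c : O (iota c) by have [G <-] := evK c; apply: RO; exists G.
have Ms : nonunits O (ev s) by apply: IO; exists s.
have [P [Pge Pgt]] := discrete_place rO valO KO Ms evs degs.
exists P; split=> [G|G rG evG]; first by apply/Pge/RO; exists G.
by apply: Pgt => //; apply: IO; exists G.
Qed.

Section PlacePolynomial.
Variables (K F : fieldType) (iota : {rmorphism K -> F}) (P : place iota) (t : F).
Local Notation peval := (peval iota).

Lemma val_peval_neg c : P t < 0 -> c != 0 ->
  peval t c != 0 /\ P (peval t c) = P t *+ (size c).-1.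
Proof.
move=> Pt c0; have t0 : t != 0 by apply: contraTneq Pt => ->; rewrite val_at0.
have [n sc] : exists n, size c = n.+1 by exists (size c).-1; rewrite prednK // size_poly_gt0.
have lc : iota c`_n != 0 by move: c0; rewrite -lead_coef_eq0 lead_coefE sc fmorph_eq0.
have top : iota c`_n * t ^+ n != 0 by rewrite mulf_neq0 ?expf_neq0.
have Ptop : P (iota c`_n * t ^+ n) = P t *+ n.
  by rewrite val_atM ?expf_neq0 // val_atK ?add0r ?val_exp //; move: lc; rewrite fmorph_eq0.
rewrite peval_sum sc big_ord_recr /= addrC -Ptop; apply: val_add_lt => //.
apply: vge_sum => i _; apply: vgeZ => _; rewrite Ptop val_exp; have := ltn_ord i; nia.
Qed.

Lemma vge_center b : 0 < P (t - iota b) -> vge P t 0.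
Proof.
move=> Ptb; rewrite -[t](subrK (iota b)); apply: vgeD; last exact: vgeK.
by move=> _; apply: ltW.
Qed.

Lemma val_peval_center b c : 0 < P (t - iota b) -> c.[b] != 0 ->
  peval t c != 0 /\ P (peval t c) = 0.
Proof.
move=> Ptb cb; have /factor_theorem[q e] : root (c - c.[b]%:P) b.
  by rewrite /root hornerD hornerN hornerC subrr.
have -> : peval t c = iota c.[b] + peval t q * (t - iota b).
  by rewrite -pevalXsubC -rmorphM /= -e rmorphB /= pevalC addrC subrK.
have cb0 : iota c.[b] != 0 by rewrite fmorph_eq0.
rewrite -(val_atK P cb); apply: val_add_lt => //; rewrite val_atK //.
apply: vgeM; last by move=> _; rewrite -gtz0_ge1.
by apply: vge_peval; apply: vge_center Ptb.
Qed.

Lemma val_peval_multiple b c : 0 < P (t - iota b) -> c != 0 ->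
  exists k, P (peval t c) = P (t - iota b) *+ k.
Proof.
move=> Ptb c0; have [k [q]] := multiplicity_XsubC c b; rewrite c0 /= => qb ->.
have [q0 Pq] := val_peval_center Ptb qb; exists k.
rewrite rmorphM rmorphXn /= pevalXsubC val_atM ?Pq ?add0r ?val_exp //.
by apply: expf_neq0; apply: contraTneq Ptb => ->; rewrite val_at0.
Qed.

End PlacePolynomial.
Lemma sumX_pchar (R : comNzRingType) (p k : nat) (I : Type) (r : seq I) (f : I -> R) :
  prime p -> p \in [pchar R] -> (\sum_(i <- r) f i) ^+ (p ^ k) = \sum_(i <- r) f i ^+ (p ^ k).
Proof.
move=> pr cR; have pk : [pchar R].-nat (p ^ k)%N by rewrite pnatX pnatE ?cR.
apply: (big_morph (fun z => z ^+ (p ^ k))) => [z w|]; first exact: exprDn_pchar.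
by rewrite expr0n -[_ == 0]negbK -lt0n expn_gt0 prime_gt0.
Qed.

Lemma affine_exp (R : comNzRingType) (c d : R) n :
  (size ((c%:P * 'X + d%:P) ^+ n)%R <= n.+1)%N /\ ((c%:P * 'X + d%:P) ^+ n)`_n = c ^+ n.
Proof.
elim: n => [|n [sn cn]]; first by rewrite !expr0 size_poly1 coef1.
have s2 : (size (c%:P * 'X + d%:P)%R <= 2)%N.
  apply: leq_trans (size_polyD _ _) _; rewrite geq_max; apply/andP; split.
    by rewrite mul_polyC; apply: leq_trans (size_scale_leq _ _) _; rewrite size_polyX.
  by apply: leq_trans (size_polyC_leq1 _) _.
rewrite !exprS; split; first by apply: leq_trans (size_polyMleq _ _) _; lia.
rewrite mulrDl -mulrA coefD !coefCM coefXM /= cn [X in _ + _ * X]nth_default ?mulr0 ?addr0 //.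
Qed.

Lemma irreducible_factor (K : fieldType) (c : {poly K}) : c != 0 -> (1 < size c)%N ->
  exists2 q : {poly K}, (1 < size q)%N /\ q %| c
    & forall d, (q %| d) || coprimep q d.
Proof.
move=> c0 sc; pose S n := exists q : {poly K}, [/\ size q = n, (1 < size q)%N & q %| c].
have ex0 : exists n, `[< S n >] by exists (size c); apply/asboolP; exists c.
case: (ex_minnP ex0) => n /asboolP[q [sq q1 qc]] minn.
exists q => // d; have q0 : q != 0 by rewrite -size_poly_gt0 ltnW.
have gq : gcdp q d %| q by exact: dvdp_gcdl.
have g0 : gcdp q d != 0 by rewrite gcdp_eq0 negb_and q0.
have [g1|g1] := leqP (size (gcdp q d)) 1.
  by apply/orP; right; rewrite coprimep_def eqn_leq g1 size_poly_gt0.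
have : `[< S (size (gcdp q d)) >].
  by apply/asboolP; exists (gcdp q d); split=> //; apply: dvdp_trans qc.
move/minn; rewrite -sq => le; apply/orP; left.
have : gcdp q d %= q by rewrite -dvdp_size_eqp // eqn_leq le dvdp_leq.
by move/eqp_dvdl <-; apply: dvdp_gcdr.
Qed.

(* If z is not integral over K[x], then 1/z generates a proper ideal of K[x, 1/z]
   and thus vanishes at some place which is finite on K[x]. *)
Lemma integral_of_vge (K F : fieldType) (iota : {rmorphism K -> F}) (x z : F) :
  (forall z, z != 0 -> exists2 q : {poly {poly K}}, q`_0 != 0 & peval (peval iota x) z q = 0) ->
  (forall c : {poly K}, c != 0 -> peval iota x c != 0 /\ exists N, deg_le iota (peval iota x c)
    N) ->
  (forall P : place iota, vge P x 0 -> vge P z 0) ->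
  exists n (c : 'I_n -> {poly K}), z ^+ n = \sum_(i < n) peval iota x (c i) * z ^+ i.
Proof.
move=> algx degx Pz; have [->|z0] := eqVneq z 0.
  by exists 1%N, (fun=> 0); rewrite big_ord1 rmorph0 mul0r expr1.
pose ev G := peval (peval iota x) z^-1 G.
have evB G H : ev (G - H) = ev G - ev H by rewrite /ev rmorphB.
have evM G H : ev (G * H) = ev G * ev H by rewrite /ev rmorphM.
have evX : ev 'X = z^-1 by rewrite /ev pevalX.
have evC c : ev c%:P = peval iota x c by rewrite /ev pevalC.
pose R : set F := [set w | exists G, w = ev G].
pose I : set F := [set w | exists G, w = ev ('X * G)].
have rR : ring_set R.
  split; first by exists 1; rewrite /ev rmorph1.
    by move=> _ _ [G ->] [H ->]; exists (G - H); rewrite evB.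
  by move=> _ _ [G ->] [H ->]; exists (G * H); rewrite evM.
have iI : ideal_in R I.
  split; first by move=> _ [G ->]; exists ('X * G).
  - by exists 0; rewrite mulr0 /ev rmorph0.
  - by move=> _ _ [G ->] [H ->]; exists (G - H); rewrite mulrBr evB.
  by move=> _ _ [G ->] [H ->]; exists (G * H); rewrite -evM mulrCA.
apply: contrapT => noint.
have nI1 : ~ I 1.
  case=> G; rewrite evM evX => e; apply: noint.
  exists (size G), (fun i => G`_(size G - i.+1)).
  rewrite -[z ^+ _]mulr1 e /ev peval_sum !mulr_sumr [RHS](reindex_inj rev_ord_inj) /=.
  apply: eq_bigr => i _; have lt_i := ltn_ord i.
  rewrite subnSK // subKn; last exact: ltnW.
  have -> : z ^+ size G = z ^+ (size G - i.+1) * z * z ^+ i.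
    by rewrite -exprSr -exprD subnSK // subnK // ltnW.
  by rewrite exprVn; field; rewrite z0 expf_neq0.
have [O [rO RO valO IO]] := chevalley rR iI nI1.
have KO c : O (iota c) by apply: RO; exists c%:P%:P; rewrite evC pevalC.
have zi0 : z^-1 != 0 by rewrite invr_eq0.
(* The constant coefficient of an equation for 1/z is a nonzero element of K[x] divisible by 1/z; it
   serves as the parameter with a known degree bound. *)
have [q q0 qz] := algx z^-1 zi0; have [w0 [N degw]] := degx _ q0.
have Mw : nonunits O (peval iota x q`_0).
  apply: IO; exists (- drop_poly 1 q); rewrite mulrN /ev rmorphN.
  have := qz; rewrite [in X in X -> _](poly_split q) rmorphD /= pevalC => /eqP.
  by rewrite addr_eq0 => /eqP.
have [P [Pge Pgt]] := discrete_place rO valO KO Mw w0 degw.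
have Mz : nonunits O z^-1 by apply: IO; exists 1; rewrite mulr1 evX.
have := Pgt _ Mz zi0; rewrite val_inv oppr_gt0 ltNge => /negP; apply.
apply: Pz z0; apply: Pge; apply: RO; exists 'X%:P; by rewrite evC pevalX.
Qed.

(** * Riemann-Roch spaces *)

Section RiemannRoch.
Variables (K F : fieldType) (iota : {rmorphism K -> F}).
Implicit Types (P : place iota) (A B : place iota -> int).

Lemma riemann_rochE A : riemann_roch_space A = [set z | forall P, vge P z (- A P)].
Proof.
apply/seteqP; split=> z /=; first by case=> [-> P|Pz P _]; [exact: vge0|].
by move=> Pz; have [->|z0] := eqVneq z 0; [left|right=> P; apply: Pz].
Qed.

Lemma riemann_roch_subspace A : subspace iota (riemann_roch_space A).
Proof.
rewrite riemann_rochE; split=> [P|z w Az Aw P|c z Az P]; first exact: vge0.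
  exact: vgeD.
exact: vgeZ.
Qed.

Lemma riemann_roch_mono A B : (forall P, A P <= B P) ->
  riemann_roch_space A `<=` riemann_roch_space B.
Proof.
rewrite !riemann_rochE => AB z Az P; apply: vgeW (Az P); rewrite lerN2; exact: AB.
Qed.

Lemma dim_le_leq V W d d' : subspace iota W -> (d <= d')%N ->
  dim_le iota V W d -> dim_le iota V W d'.
Proof.
move=> [W0 _ _] le dV; rewrite -(subnKC le); apply: dim_le_trans dV _.
exists (fun=> 0) => z Wz; exists (fun=> 0).
by rewrite big1 ?subr0 // => i _; rewrite mulr0.
Qed.

Lemma dim_le_bounded V W d : subspace iota V -> subspace iota W ->
  (forall n, dim_ge iota V W n -> (n <= d)%N) -> dim_le iota V W d.
Proof.
move=> sV sW bnd; have [n [e be]] := quotient_basis_exists sV sW bnd.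
have [V0 _ _] := sV.
apply: dim_le_leq (quotient_basis_dim_le be) => //.
exact/bnd/(quotient_basis_dim_ge V0 sW be).
Qed.

(** Under this condition [place_degree P] is a true dimension and not the default 0. *)
Definition has_parameter P : Prop := exists t N, [/\ t != 0, deg_le iota t N & 0 < P t].

(** Multiplication by T^(A(P) + 1), with T a uniformizer, embeds L(A + P) / L(A) in the residue
    field of P. *)
Lemma riemann_roch_step A P : has_parameter P ->
  dim_le iota (riemann_roch_space (fun P' => A P' + (P' == P)%:Z)) (riemann_roch_space A)
    (place_degree P).
Proof.
case=> t [N [t0 degt Pt]]; apply: dim_le_bounded; try exact: riemann_roch_subspace.
move=> n [e []]; rewrite !riemann_rochE => Ve fe.
have [T T0 PT] := uniformizer P; have TP : T ^ (A P + 1) != 0 by apply: expfz_neq0.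
have PTP : P (T ^ (A P + 1)) = A P + 1 by rewrite val_expz PT mulr1.
apply: (@dim_ge_le _ _ iota (valuation_ring P) (maximal_ideal P)).
- by rewrite maximal_idealE; apply: vge_subspace.
- exists (fun i => T ^ (A P + 1) * e i); rewrite valuation_ringE maximal_idealE.
  split=> [i|c /=].
    have := Ve i P; rewrite eqxx /= => Pe.
    by rewrite -[0](subrr (A P + 1)); apply: vgeM => // _; rewrite PTP.
  have -> : \sum_i iota (c i) * (T ^ (A P + 1) * e i) = T ^ (A P + 1) * \sum_i iota (c i) * e i.
    by rewrite mulr_sumr; apply: eq_bigr => i _; rewrite mulrCA.
  move=> Pc; apply: fe => P'; have [->|P'P] := eqVneq P' P.
    move=> s0; have := Pc (mulf_neq0 TP s0); rewrite val_atM // PTP; lia.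
  apply: vge_sum => i _; apply: vgeZ; have := Ve i P'; by rewrite (negPf P'P) addr0.
- exact: place_degree_dim_le t0 degt P Pt.
Qed.

Lemma riemann_roch_raise A P k : has_parameter P ->
  dim_le iota (riemann_roch_space (fun P' => A P' + ((P' == P) * k)%N%:Z)) (riemann_roch_space A)
    (k * place_degree P).
Proof.
move=> pP; elim: k => [|k IH].
  exists (fun=> 0) => z; rewrite !riemann_rochE => Az; exists (fun=> 0).
  rewrite big_ord0 subr0 => P'; apply: vgeW (Az P'); by rewrite muln0 addr0.
rewrite mulSn; apply: dim_le_trans IH.
have := riemann_roch_step (fun P' => A P' + ((P' == P) * k)%N%:Z) pP.
congr (dim_le _ (riemann_roch_space _) _ _); apply/funext => P'; case: (P' == P); lia.
Qed.

Lemma riemann_roch_total A s (n : place iota -> nat) : uniq s -> (forall P, has_parameter P) ->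
  dim_le iota (riemann_roch_space (fun P => A P + (if P \in s then (n P)%:Z else 0)))
    (riemann_roch_space A) (\sum_(P <- s) n P * place_degree P).
Proof.
move=> + hp; elim: s => [_|P s IH /= /andP[Ps us]].
  rewrite big_nil; exists (fun=> 0) => z; rewrite !riemann_rochE => Az; exists (fun=> 0).
  rewrite big_ord0 subr0 => P'; apply: vgeW (Az P'); by rewrite addr0.
rewrite big_cons; apply: dim_le_trans (IH us).
have := riemann_roch_raise (fun P => A P + (if P \in s then (n P)%:Z else 0)) (n P) (hp P).
congr (dim_le _ (riemann_roch_space _) _ _); apply/funext => P'; rewrite inE.
by have [->|_] := eqVneq P' P; rewrite ?(negPf Ps) /=; lia.
Qed.

Lemma divisor_support A : is_divisor A -> exists2 s, uniq s & forall P, P \notin s -> A P = 0.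
Proof.
move=> /finite_seqP[s sE]; exists (undup s); first exact: undup_uniq.
move=> P; rewrite mem_undup => Ps; apply: contrapT => /eqP AP.
have : [set P | A P != 0] P by [].
by rewrite sE /= (negPf Ps).
Qed.

(** Stated for the quotient of the two spaces, so that, starting from L(0), it also proves that
    Riemann-Roch spaces are finite-dimensional. *)
Lemma riemann_roch_dim_le A B : (forall P, has_parameter P) -> is_divisor A -> is_divisor B ->
  (forall P, A P <= B P) -> exists2 d : nat,
    dim_le iota (riemann_roch_space B) (riemann_roch_space A) d &
    d%:Z = divisor_degree B - divisor_degree A.
Proof.
move=> hp /divisor_support[sA uA A0] /divisor_support[sB uB B0] AB.
pose s := undup (sA ++ sB); have us : uniq s by exact: undup_uniq.
have sA0 P : P \notin s -> A P = 0.
  by rewrite mem_undup mem_cat negb_or => /andP[/A0].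
have sB0 P : P \notin s -> B P = 0.
  by rewrite mem_undup mem_cat negb_or => /andP[_ /B0].
exists (\sum_(P <- s) `|B P - A P|%N * place_degree P)%N.
  have := riemann_roch_total A (fun P => `|B P - A P|%N) us hp.
  congr (dim_le _ (riemann_roch_space _) _ _); apply/funext => P; case: ifP => Ps.
    have := AB P; lia.
  by rewrite sA0 ?sB0 ?Ps.
rewrite (divisor_degree_seq us sA0) (divisor_degree_seq us sB0) -sumrB -[LHS]natz natr_sum.
apply: eq_bigr => P _; rewrite natz PoszM gez0_abs ?subr_ge0 // mulrBl //.
Qed.

End RiemannRoch.

(** * The curve Tr(y) = A(x) / h(x) *)

Section TracePolynomial.
Variables (p u : nat).
Hypotheses (p_prime : prime p) (u_gt0 : (0 < u)%N).

Lemma trace_polyD (R : nzRingType) :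
  exists2 q : {poly R}, trace_poly R p u = 'X^(p ^ (u - 1)) + q & (size q <= p ^ (u - 1))%N.
Proof.
case: u u_gt0 => // v _; rewrite /trace_poly big_ord_recr /= subn1 addrC.
exists (\sum_(i < v) 'X^(p ^ i)) => //.
apply: leq_trans (size_sum _ _ _) _; apply/bigmax_leqP => i _.
by rewrite size_polyXn ltn_exp2l // prime_gt1.
Qed.

Lemma size_trace_poly (R : nzRingType) : size (trace_poly R p u) = (p ^ (u - 1)).+1.
Proof. by have [q -> sq] := trace_polyD R; rewrite size_polyDl size_polyXn. Qed.

Lemma trace_poly_monic (R : nzRingType) : trace_poly R p u \is monic.
Proof.
have [q -> sq] := trace_polyD R.
by rewrite monicE lead_coefDl ?size_polyXn // lead_coefXn.
Qed.

Lemma horner_trace (R : comNzRingType) (z : R) :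
  (trace_poly R p u).[z] = \sum_(i < u) z ^+ (p ^ i).
Proof. by rewrite /trace_poly horner_sum; apply: eq_bigr => i _; rewrite hornerXn. Qed.

End TracePolynomial.

Section Curve.
Variables (K F : fieldType) (iota : {rmorphism K -> F}) (p u : nat) (a b : seq K) (x y : F).
Local Notation biv x y := (peval (peval iota x) y).
Local Notation ev := (peval iota).
Local Notation m := (p ^ (u - 1))%N.
Variables (A h : {poly K}).
Hypotheses (A_def : A = \prod_(c <- a) ('X - c%:P)) (h_def : h = \prod_(c <- b) ('X - c%:P)).
Hypotheses (p_prime : prime p) (u_gt0 : (0 < u)%N) (size_a : size a = (size b).+1)
  (ab_uniq : uniq (a ++ b)) (x_transc : ~ algebraicOver iota x)
  (F_gen : adjoin iota [set x; y] = [set: F])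
  (F_eq : ev x h * (trace_poly F p u).[y] = ev x A).

Lemma ramification_gt0 : (0 < m)%N.
Proof. by rewrite expn_gt0 prime_gt0. Qed.

Lemma peval_x_neq0 c : c != 0 -> ev x c != 0.
Proof. by rewrite peval_eq0. Qed.

Lemma h_neq0 : h != 0.
Proof. by rewrite h_def; apply/monic_neq0/monic_prod_XsubC. Qed.

Definition curve_poly : {poly {poly K}} := h%:P * trace_poly {poly K} p u - A%:P.

Lemma biv_trace : biv x y (trace_poly {poly K} p u) = (trace_poly F p u).[y].
Proof.
rewrite horner_trace /trace_poly rmorph_sum /=.
by apply: eq_bigr => i _; rewrite rmorphXn /= pevalX.
Qed.

Lemma peval_trace z : ev z (trace_poly K p u) = (trace_poly F p u).[z].
Proof.
rewrite horner_trace /trace_poly rmorph_sum /=.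
by apply: eq_bigr => i _; rewrite rmorphXn /= pevalX.
Qed.

Lemma biv_affine s t (c d : {poly K}) (T : {poly {poly K}}) :
  biv s t (c%:P * T - d%:P) = ev s c * biv s t T - ev s d.
Proof. by rewrite rmorphB rmorphM /= !bivC. Qed.

Lemma biv_curve_poly : biv x y curve_poly = 0.
Proof.
apply: etrans (biv_affine x y h A (trace_poly {poly K} p u)) _.
by rewrite biv_trace F_eq subrr.
Qed.

Let size_hTr : size (h%:P * trace_poly {poly K} p u) = m.+1.
Proof. by rewrite mul_polyC size_scale ?h_neq0 // size_trace_poly. Qed.

Let size_A1 : (size (A%:P : {poly {poly K}}) < m.+1)%N.
Proof. by apply: leq_ltn_trans (size_polyC_leq1 _) _; rewrite ltnS ramification_gt0. Qed.

Lemma size_curve_poly : size curve_poly = m.+1.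
Proof. by rewrite /curve_poly size_polyDl size_hTr // size_polyN. Qed.

Lemma lead_coef_curve_poly : lead_coef curve_poly = h.
Proof.
rewrite /curve_poly lead_coefDl ?size_polyN ?size_hTr // mul_polyC lead_coefZ.
by rewrite (monicP (trace_poly_monic p_prime u_gt0 _)) mulr1.
Qed.

(** The leading coefficient of [curve_poly] is h, so lowering the degree in y costs powers of h. *)
Lemma curve_reduce (G : {poly {poly K}}) : exists k (R : {poly {poly K}}),
  (size R <= m)%N /\ ev x h ^+ k * biv x y G = biv x y R.
Proof.
have [|k [R [sR e]]] := @biv_reduce _ _ iota x y curve_poly G _ biv_curve_poly.
  by rewrite -size_poly_eq0 size_curve_poly.
by exists k, R; rewrite -lead_coef_curve_poly -ltnS -size_curve_poly.
Qed.

(** * Coordinates over K(x) in the powers of y *)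

Definition reduced (z : F) (c : {poly K}) (R : {poly {poly K}}) : Prop :=
  [/\ c != 0, (size R <= m)%N & ev x c * z = biv x y R].

Definition represented (z : F) : Prop := exists c R, reduced z c R.

Lemma representedI z (c : {poly K}) (G : {poly {poly K}}) :
  c != 0 -> ev x c * z = biv x y G -> represented z.
Proof.
move=> c0 e; have [k [R [sR eR]]] := curve_reduce G.
exists (h ^+ k * c), R; split=> //; first by rewrite mulf_neq0 // expf_neq0 // h_neq0.
by rewrite rmorphM rmorphXn /= -mulrA e.
Qed.

Lemma represented_biv G : represented (biv x y G).
Proof. by apply: (@representedI _ 1 G); rewrite ?oner_neq0 // rmorph1 mul1r. Qed.

Lemma represented_peval c : represented (ev x c).
Proof. by rewrite -(bivC iota x y); apply: represented_biv. Qed.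

Lemma representedM z w : represented z -> represented w -> represented (z * w).
Proof.
move=> [c [R [c0 _ e]]] [d [S [d0 _ f]]].
apply: (@representedI _ (c * d) (R * S)); first by rewrite mulf_neq0.
by rewrite !rmorphM /= -e -f; ring.
Qed.

Lemma representedB z w : represented z -> represented w -> represented (z - w).
Proof.
move=> [c [R [c0 _ e]]] [d [S [d0 _ f]]].
apply: (@representedI _ (c * d) (d%:P * R - c%:P * S)); first by rewrite mulf_neq0.
by rewrite rmorphM rmorphB !rmorphM /= -e -f !bivC; ring.
Qed.

Lemma represented_pevalV c : represented (ev x c)^-1.
Proof.
have [->|c0] := eqVneq c 0; first by rewrite rmorph0 invr0 -(rmorph0 (ev x));
  apply: represented_peval.
apply: (@representedI _ c 1) => //.
by rewrite rmorph1 divff // peval_x_neq0.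
Qed.

Lemma representedX z n : represented z -> represented (z ^+ n).
Proof.
move=> rz; elim: n => [|n IH]; last by rewrite exprS; apply: representedM.
by rewrite expr0 -(rmorph1 (ev x)); apply: represented_peval.
Qed.

Lemma represented_sum (I : Type) (r : seq I) (Q : pred I) (f : I -> F) :
  (forall i, Q i -> represented (f i)) -> represented (\sum_(i <- r | Q i) f i).
Proof.
have r0 : represented 0 by rewrite -(rmorph0 (ev x)); apply: represented_peval.
move=> rf; elim/big_ind: _ => // z w rz rw.
by rewrite -[w]opprK -[- w]sub0r; apply: representedB => //; apply: representedB.
Qed.

Lemma common_denominator (I : finType) (z : I -> F) : (forall i, represented (z i)) ->
  exists2 c, c != 0 & exists R : I -> {poly {poly K}}, forall i, reduced (z i) c (R i).
Proof.
move=> /choice[c] /choice[R cR].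
exists (\prod_i c i); first by apply/prodf_neq0 => i _; case: (cR i).
exists (fun i => (\prod_(j | j != i) c j) *: R i) => i; have [c0 sR e] := cR i; split.
- by apply/prodf_neq0 => j _; case: (cR j).
- exact: leq_trans (size_scale_leq _ _) sR.
by rewrite -mul_polyC rmorphM /= bivC -e (bigD1 i) //= rmorphM /=; ring.
Qed.

Lemma represented_deg (I : finType) (z : I -> F) (c1 c2 : {poly K}) d :
  (forall i, represented (z i)) -> (size c1 <= d.+1)%N -> (size c2 <= d.+1)%N -> c2 != 0 ->
  indep iota (ev x c1 / ev x c2) z -> (#|I| <= m * d)%N.
Proof.
move=> /common_denominator[c c0 [R cR]] s1 s2 c20.
apply: (@counting _ _ iota I z x m d (fun j => y ^+ j) (ev x c) (fun i j => (R i)`_j)) => //.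
- exact: peval_x_neq0.
- by move=> i; have [_ sR ->] := cR i; apply: peval_widen.
- exact: peval_x_neq0.
Qed.

(** The nonzero constant term matters: it makes 1/z a polynomial in z over K(x), and it produces a
    nonzero element of K[x] that vanishes wherever z does at a place finite on x. *)
Lemma represented_algebraic z : represented z -> z != 0 ->
  exists2 q : {poly {poly K}}, q`_0 != 0 & biv x z q = 0.
Proof.
move=> rz z0.
have [phi [sum0 [i phi0]]] : exists phi : 'I_m.+1 -> {poly K},
    \sum_i ev x (phi i) * z ^+ i = 0 /\ exists i, phi i != 0.
  apply: contrapT => no.
  have : (#|'I_m.+1| <= m * 1)%N; last by rewrite card_ord muln1 ltnn.
  apply: (@represented_deg _ (fun i : 'I_m.+1 => z ^+ i) 'X 1 1).
  - by move=> i; apply: representedX.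
  - by rewrite size_polyX.
  - by rewrite size_poly1.
  - exact: oner_neq0.
  move=> phi; rewrite pevalX rmorph1 divr1 => sum0 i; apply/eqP; rewrite -[_ == _]negbK;
    apply/negP => phi0.
  by apply: no; exists phi; split=> //; exists i.
pose Phi := \poly_(i < m.+1) phi (inord i).
have Phi0 : Phi != 0.
  apply/eqP => /(congr1 (fun q : {poly {poly K}} => q`_i)).
  rewrite coef0 coef_poly ltn_ord => /eqP; rewrite inord_val; exact/negP.
have zPhi : biv x z Phi = 0.
  rewrite (peval_widen _ _ (size_poly _ _)) -[RHS]sum0; apply: eq_bigr => j _.
  by rewrite coef_poly ltn_ord inord_val.
have [k [q]] := multiplicity_XsubC Phi 0; rewrite Phi0 /= => q0 eq.
exists q; first by move: q0; rewrite /root horner_coef0.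
move: zPhi; rewrite eq rmorphM rmorphXn rmorphB /= pevalX bivC rmorph0 subr0 => /eqP.
by rewrite mulf_eq0 expf_eq0 (negPf z0) andbF orbF => /eqP.
Qed.

Lemma representedV z : represented z -> represented z^-1.
Proof.
move=> rz; have [->|z0] := eqVneq z 0; first by rewrite invr0 -(rmorph0 (ev x));
  apply: represented_peval.
have [q q0 zq] := represented_algebraic rz z0.
have -> : z^-1 = biv x z (- drop_poly 1 q) * (ev x q`_0)^-1.
  have P0 := peval_x_neq0 q0; apply: (mulIf P0); rewrite divfK //; apply: (mulfI z0).
  rewrite mulrA divff // mul1r; apply/eqP; rewrite -subr_eq0 rmorphN mulrN opprK; apply/eqP.
  by rewrite -[RHS]zq [in RHS](poly_split q) rmorphD rmorphM /= bivC pevalX.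
apply: representedM; last exact: represented_pevalV.
rewrite (peval_widen _ _ (leqnn _)); apply: represented_sum => i _.
by apply: representedM; [apply: represented_peval|apply: representedX].
Qed.

Lemma all_represented z : represented z.
Proof.
have : adjoin iota [set x; y] z by rewrite F_gen.
move/(_ (fun w => `[< represented w >])) => /(_ _ _ _)/asboolP; apply.
- split=> [|v w|v w].
  + by apply/asboolP; rewrite -(rmorph1 (ev x)); apply: represented_peval.
  + by move=> /asboolP rv /asboolP rw; apply/asboolP; apply: representedB.
  + by move=> /asboolP rv /asboolP rw; apply/asboolP; apply: representedM => //;
    apply: representedV.
- by move=> c; apply/asboolP; rewrite -(pevalC iota x); apply: represented_peval.
by move=> w [->|->]; apply/asboolP; [rewrite -(pevalX iota x);
  apply: represented_peval|rewrite -(pevalX (ev x) y); apply: represented_biv].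
Qed.

Lemma deg_le_x (c1 c2 : {poly K}) d : (size c1 <= d.+1)%N -> (size c2 <= d.+1)%N -> c2 != 0 ->
  deg_le iota (ev x c1 / ev x c2) (m * d).
Proof.
move=> s1 s2 c20 n z /(represented_deg (fun i => all_represented (z i)) s1 s2 c20).
by rewrite card_ord.
Qed.

Lemma deg_le_poly (w : {poly K}) : deg_le iota (ev x w) (m * (size w).-1).
Proof.
rewrite -[ev x w]divr1 -(rmorph1 (ev x)); apply: deg_le_x; rewrite ?oner_neq0 //.
  by case: (size w).
by rewrite size_poly1.
Qed.

Lemma algebraic_over_Kx z : z != 0 ->
  exists2 q : {poly {poly K}}, q`_0 != 0 & biv x z q = 0.
Proof. exact/represented_algebraic/all_represented. Qed.

Lemma size_A : size A = (size a).+1.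
Proof. by rewrite A_def size_prod_XsubC. Qed.

Lemma size_h : size h = size a.
Proof. by rewrite h_def size_prod_XsubC size_a. Qed.

(** Over K[y], x is a root of A(X) - Tr(y) h(X), which is monic of degree [size a] because deg h <
    deg A. *)
Lemma deg_le_y : deg_le iota y (size a).
Proof.
move=> n z indz.
have [c c0 [R cR]] := common_denominator (fun i => all_represented (z i)).
pose Psi : {poly {poly K}} := map_poly polyC A - (trace_poly K p u)%:P * map_poly polyC h.
have sA : size (map_poly polyC A : {poly {poly K}}) = (size a).+1.
  by rewrite size_map_inj_poly // ?size_A //; apply: polyC_inj.
have sh : (size ((trace_poly K p u)%:P * map_poly polyC h)%R <= size a)%N.
  rewrite mul_polyC; apply: leq_trans (size_scale_leq _ _) _.
  by rewrite size_map_inj_poly ?size_h //; apply: polyC_inj.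
have sPsi : size Psi = (size a).+1 by rewrite /Psi size_polyDl ?sA // size_polyN ltnS.
have mPsi : lead_coef Psi = 1.
  rewrite /Psi lead_coefDl ?sA ?size_polyN ?ltnS // lead_coef_map_inj //; last exact: polyC_inj.
  by rewrite A_def (monicP (monic_prod_XsubC _ _ _)).
have Psi0 : biv y x Psi = 0.
  by rewrite /Psi rmorphB rmorphM /= !peval_map_polyC bivC peval_trace -F_eq mulrC subrr.
have /choice[H HP] i : exists H : {poly {poly K}}, (size H <= size a)%N /\ ev x c * z i = biv y x H.
  have [_ _ ->] := cR i; have [G ->] := biv_swap iota x y (R i).
  have [|k [H [sH e]]] := @biv_reduce _ _ iota y x Psi G _ Psi0;
    first by rewrite -size_poly_eq0 sPsi.
  by exists H; rewrite -ltnS -sPsi -e mPsi rmorph1 expr1n mul1r.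
rewrite -[n]card_ord -[size a]muln1.
apply: (@counting _ _ iota _ z y (size a) 1 (fun j => x ^+ j) (ev x c) (fun i j => (H i)`_j) 'X
  1) => //.
- exact: peval_x_neq0.
- by move=> i; have [sH ->] := HP i; apply: peval_widen.
- by rewrite size_polyX.
- by rewrite size_poly1.
- by rewrite rmorph1 oner_neq0.
- by rewrite pevalX rmorph1 divr1.
Qed.

(** * Ramification over infinity and over the b_i, and existence of places *)

Local Notation tr z := ((trace_poly F p u).[z]).

Lemma val_trace (P : place iota) z : P z < 0 -> tr z != 0 /\ P (tr z) = P z *+ m.
Proof.
move=> Pz; have z0 : z != 0 by apply: contraTneq Pz => ->; rewrite val_at0.
case: u u_gt0 => // v _; rewrite horner_trace big_ord_recr /= subn1 /= addrC -val_exp.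
apply: val_add_lt; first exact: expf_neq0.
apply: vge_sum => i _ _; rewrite !val_exp.
have : (p ^ i < p ^ v)%N by rewrite ltn_exp2l // prime_gt1.
nia.
Qed.

Lemma vge_trace (P : place iota) z : vge P z 0 -> vge P (tr z) 0.
Proof. by move=> Pz; rewrite horner_trace; apply: vge_sum => i _; apply: vgeX. Qed.

Lemma val_y (P : place iota) : P (tr y) < 0 -> P y < 0 /\ P y *+ m = P (tr y).
Proof.
move=> Pt; have Py : P y < 0; last by have [_ ->] := val_trace Py.
have t0 : tr y != 0 by apply: contraTneq Pt => ->; rewrite val_at0.
rewrite ltNge; apply/negP => Py; have := @vge_trace P y (fun=> Py) t0.
by rewrite leNgt Pt.
Qed.

Lemma A_neq0 : A != 0.
Proof. by rewrite A_def; apply/monic_neq0/monic_prod_XsubC. Qed.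

Lemma trace_y : tr y = ev x A / ev x h.
Proof. by rewrite -F_eq [_ * tr y]mulrC mulfK // peval_x_neq0 // h_neq0. Qed.

Lemma trace_y_neq0 : tr y != 0.
Proof. by rewrite trace_y mulf_neq0 ?invr_eq0 ?peval_x_neq0 ?h_neq0 ?A_neq0. Qed.

Lemma y_neq0 : y != 0.
Proof.
apply: contra_neq trace_y_neq0 => ->; rewrite horner_trace big1 // => i _.
by rewrite expr0n -[_ == 0]negbK -lt0n expn_gt0 prime_gt0.
Qed.

Lemma x_neq0 : x != 0.
Proof. by apply/eqP => x0; apply: x_transc; rewrite x0; apply: algebraic0. Qed.

Lemma val_trace_y (P : place iota) : P (tr y) = P (ev x A) - P (ev x h).
Proof. by rewrite trace_y val_div ?peval_x_neq0 ?h_neq0 ?A_neq0. Qed.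

(** Since deg A = deg h + 1, Tr(y) has the pole order of x. *)
Lemma val_trace_y_infty (P : place iota) : P x < 0 -> P (tr y) = P x.
Proof.
move=> Px; rewrite val_trace_y.
have [_ ->] := val_peval_neg Px A_neq0; have [_ ->] := val_peval_neg Px h_neq0.
rewrite size_A size_h size_a /= mulrS; lia.
Qed.

Lemma root_h c : (h.[c] == 0) = (c \in b).
Proof. by rewrite h_def -root_prod_XsubC. Qed.

Lemma root_A c : (A.[c] == 0) = (c \in a).
Proof. by rewrite A_def -root_prod_XsubC. Qed.

Lemma val_trace_y_pole (P : place iota) c : c \in b -> 0 < P (x - iota c) ->
  P (tr y) = - P (x - iota c).
Proof.
move=> cb Pc; rewrite val_trace_y.
move: ab_uniq; rewrite cat_uniq => /and3P[ua /hasPn ab ub].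
have [|_ ->] := val_peval_center (c := A) Pc; first by rewrite root_A ab.
have -> : h = ('X - c%:P) * \prod_(d <- rem c b) ('X - d%:P).
  by rewrite h_def (perm_big _ (perm_to_rem cb)) big_cons.
have [|q0 Pq] := val_peval_center (c := \prod_(d <- rem c b) ('X - d%:P)) Pc.
  have := root_prod_XsubC (rem c b) c; rewrite /root => ->.
  by rewrite mem_rem_uniq // inE eqxx.
rewrite rmorphM /= pevalXsubC val_atM ?Pq ?addr0 ?sub0r //.
by apply: contraTneq Pc => ->; rewrite val_at0.
Qed.

(** Total ramification in the form that is used: values on K[x] are multiples of m, so that
    multiplication by y^j, 0 <= j < m, moves them to distinct classes modulo m. *)
Definition ramified (P : place iota) : Prop :=
  P y = -1 /\ forall c, c != 0 -> exists k : int, P (ev x c) = k * m%:Z.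

(** From m v(y) = - v(t) follows v(t) >= m, while the degree bound gives v(t) deg P <= m; equality
    must hold throughout. *)
Lemma ramified_spec (P : place iota) t : t != 0 -> deg_le iota t m -> 0 < P t ->
  P (tr y) = - P t -> [/\ P y = -1, P t = m%:Z & place_degree P = 1%N].
Proof.
move=> t0 degt Pt Ptr.
have [|Py Pym] := @val_y P; first by rewrite Ptr oppr_lt0.
have Ps Q : Q \in [:: P] -> 0 < Q t by rewrite inE => /eqP->.
have := zeros_bound t0 degt (s := [:: P]) isT Ps; rewrite big_seq1.
have := place_degree_gt0 t0 degt Pt; have := ramification_gt0.
have Pye : P y = - (`|P y|%N)%:Z by lia.
have Pte : P t = (`|P t|%N)%:Z by lia.
move: Pym Pt; rewrite Ptr -mulr_natr natz Pye Pte; move: (place_degree P) => d.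
rewrite !absz_nat; move: (`|P y|%N) (p ^ (u - 1))%N (`|P t|%N) => s M e eM e0 M0 d0 le.
have s1 : s = 1%N by have [|[|]] : s = 0%N \/ s = 1%N \/ (2 <= s)%N; [lia|nia|by []|nia].
by rewrite s1 in eM *; have eE : e = M; [lia|rewrite eE in le *; split=> //; nia].
Qed.

Lemma x_inv_neq0 : x^-1 != 0.
Proof. by rewrite invr_eq0 x_neq0. Qed.

Lemma deg_le_xV : deg_le iota x^-1 m.
Proof.
have := @deg_le_x 1 'X 1; rewrite size_poly1 size_polyX polyX_eq0 muln1 => /(_ isT isT isT).
by rewrite pevalX rmorph1 div1r.
Qed.

Lemma x_center_neq0 c : x - iota c != 0.
Proof. by rewrite -pevalXsubC peval_x_neq0 // polyXsubC_eq0. Qed.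

Lemma deg_le_center c : deg_le iota (x - iota c) m.
Proof.
have := @deg_le_poly ('X - c%:P); rewrite size_XsubC muln1; congr (deg_le iota _ _).
exact: pevalXsubC.
Qed.

Lemma infinite_place_spec (P : place iota) : P x < 0 ->
  [/\ P y = -1, P x = - m%:Z & place_degree P = 1%N].
Proof.
move=> Px; have [| |Py Pxm ->] := @ramified_spec P _ x_inv_neq0 deg_le_xV.
- by rewrite val_inv oppr_gt0.
- by rewrite val_inv opprK val_trace_y_infty.
by split=> //; rewrite -Pxm val_inv opprK.
Qed.

Lemma pole_place_spec (P : place iota) c : c \in b -> 0 < P (x - iota c) ->
  P y = -1 /\ P (x - iota c) = m%:Z.
Proof.
move=> cb Pc.
by have [] := ramified_spec (x_center_neq0 c) (@deg_le_center c) Pc (val_trace_y_pole cb Pc).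
Qed.

Lemma ramified_infinite (P : place iota) : P x < 0 -> ramified P.
Proof.
move=> Px; have [Py Pxm _] := infinite_place_spec Px; split=> // c c0.
have [_ ->] := val_peval_neg Px c0; exists (- ((size c).-1)%:Z); rewrite Pxm.
by rewrite -mulr_natr natz; lia.
Qed.

Lemma ramified_pole (P : place iota) c : c \in b -> 0 < P (x - iota c) -> ramified P.
Proof.
move=> cb Pc; have [Py Pm] := pole_place_spec cb Pc; split=> // d d0.
have [k ->] := val_peval_multiple Pc d0; exists k%:Z; rewrite Pm.
by rewrite -mulr_natr natz mulrC.
Qed.

Lemma infinite_place_exists : exists P : place iota, P x < 0.
Proof.
have tr_xV : ~ algebraicOver iota x^-1 by move/algebraic_inv; rewrite invrK.
have [|||||P [_ Pgt]] := @place_center _ _ iota _ (ev x^-1) (horner_eval 0) m 'X.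
- by move=> c; exists c%:P; rewrite /= pevalC.
- by move=> G /eqP; rewrite /= peval_eq0 // => /eqP->; rewrite rmorph0.
- by rewrite /= /horner_eval hornerX.
- by rewrite /= pevalX x_inv_neq0.
- by rewrite /= pevalX; apply: deg_le_xV.
exists P; have := Pgt 'X; rewrite /= pevalX val_inv oppr_gt0; apply; last exact: x_inv_neq0.
by rewrite /= /horner_eval hornerX.
Qed.

Lemma center_place_exists c : exists P : place iota, 0 < P (x - iota c).
Proof.
have [|||||P [_ Pgt]] := @place_center _ _ iota _ (ev x) (horner_eval c) m ('X - c%:P).
- by move=> d; exists d%:P; rewrite /= pevalC.
- by move=> G /eqP; rewrite /= peval_eq0 // => /eqP->; rewrite rmorph0.
- by rewrite /= /horner_eval hornerXsubC subrr.
- by rewrite /= pevalXsubC x_center_neq0.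
- by rewrite /= pevalXsubC; apply: deg_le_center.
exists P; have := Pgt ('X - c%:P); rewrite /= pevalXsubC; apply; last exact: x_center_neq0.
by rewrite /= /horner_eval hornerXsubC subrr.
Qed.

(** The valuation of a nonzero term R_j y^j is congruent to -j modulo m, so these valuations are
    distinct. *)
Lemma ramified_vge (P : place iota) (R : {poly {poly K}}) k : ramified P -> (size R <= m)%N ->
  vge P (biv x y R) k -> forall j : 'I_m, vge P (ev x R`_j * y ^+ j) k.
Proof.
move=> [Py Pm] sR; rewrite (peval_widen _ _ sR); apply: vge_sum_distinct => i j ij.
rewrite !mulf_eq0 !negb_or => /andP[Ri yi] /andP[Rj yj].
rewrite !val_atM // !val_exp Py.
have {}Ri : R`_i != 0 by apply: contraNneq Ri => ->; rewrite rmorph0.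
have {}Rj : R`_j != 0 by apply: contraNneq Rj => ->; rewrite rmorph0.
have [ki ->] := Pm _ Ri; have [kj ->] := Pm _ Rj.
apply: contra_neq ij => e; apply: val_inj => /=.
have := ltn_ord i; have := ltn_ord j; move: e; rewrite !mulNrn !natz.
move: (p ^ (u - 1))%N (val i) (val j) => M s t e lt lt'.
have [|[|]] : ki = kj \/ ki < kj \/ kj < ki by lia.
- by move=> ek; rewrite ek in e; lia.
- nia.
nia.
Qed.

(** Coordinates in 1, y, ..., y^(m-1) are unique: ramification at infinity keeps the terms of a
    vanishing combination apart, so each of them has valuation above every bound. *)
Lemma biv_eq0 (R : {poly {poly K}}) : (size R <= m)%N -> biv x y R = 0 -> R = 0.
Proof.
move=> sR R0; have [P Px] := infinite_place_exists.
apply/polyP => j; rewrite coef0; have [lt|le] := ltnP j m; last first.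
  by rewrite nth_default // (leq_trans sR).
apply/eqP; rewrite -(peval_eq0 _ x_transc).
suff : ev x R`_j * y ^+ j == 0 by rewrite mulf_eq0 expf_eq0 (negPf y_neq0) andbF orbF.
apply/eqP/(@vge_eq0 _ _ _ P) => k.
by have := @ramified_vge P R k (ramified_infinite Px) sR _ (Ordinal lt); apply; rewrite R0;
  apply: vge0.
Qed.

(** The place is centred at the point x = c, y = 0 of the curve, where A(c) and Tr(0) both
    vanish. *)
Lemma zero_place_exists c : c \in a -> exists P : place iota, 0 < P (x - iota c) /\ 0 < P y.
Proof.
move=> ca; pose red : {rmorphism {poly {poly K}} -> K} := peval (horner_eval c) 0.
have redC (d : {poly K}) : red d%:P = d.[c] by rewrite /red /= pevalC.
have redX : red 'X = 0 by rewrite /red /= pevalX.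
have hc : h.[c] != 0.
  move: ab_uniq; rewrite cat_uniq root_h => /and3P[_ /hasPn ab _].
  by apply/negP => /ab; rewrite /= ca.
have red_tr : red (trace_poly {poly K} p u) = 0.
  rewrite /trace_poly rmorph_sum big1 // => i _; rewrite rmorphXn redX expr0n.
  by rewrite -[_ == 0]negbK -lt0n expn_gt0 prime_gt0.
have red_psi : red curve_poly = 0.
  have affine (d e : {poly K}) (T : {poly {poly K}}) : red (d%:P * T - e%:P) = d.[c] * red T -
    e.[c].
    by rewrite rmorphB rmorphM !redC.
  apply: etrans (affine h A (trace_poly {poly K} p u)) _.
  have /eqP-> : A.[c] == 0 by rewrite root_A.
  by rewrite red_tr mulr0 subr0.
have [|||||P [_ Pgt]] := @place_center _ _ iota {poly {poly K}} (biv x y) red m ('X - c%:P)%:P.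
- by move=> d; exists d%:P%:P; rewrite /= bivC pevalC.
(* A polynomial vanishing at (x, y) is, up to a power of h, a multiple of [curve_poly], and h(c) is
   nonzero. *)
- move=> G /= G0; apply/eqP.
  have := Pdiv.Idomain.divp_eq G curve_poly; set k := scalp _ _; set R := modp _ _ => e.
  have R0 : R = 0.
    apply: biv_eq0; first by rewrite -ltnS -size_curve_poly Pdiv.Idomain.ltn_modp
      -size_poly_eq0 size_curve_poly.
    have := congr1 (biv x y) e.
    by rewrite -mul_polyC rmorphM rmorphD rmorphM /= biv_curve_poly G0 !mulr0 add0r => <-.
  have := congr1 red e.
  rewrite R0 addr0 -mul_polyC !rmorphM red_psi mulr0 redC lead_coef_curve_poly => /eqP.
  by rewrite mulf_eq0 horner_exp expf_eq0 (negPf hc) andbF.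
- by rewrite redC hornerXsubC subrr.
- by rewrite /= bivC pevalXsubC x_center_neq0.
- by rewrite /= bivC pevalXsubC; apply: deg_le_center.
exists P; split.
  have := Pgt ('X - c%:P)%:P; rewrite /= bivC pevalXsubC; apply; last exact: x_center_neq0.
  by rewrite redC hornerXsubC subrr.
by have := Pgt 'X; rewrite redX /= pevalX; apply=> //; apply: y_neq0.
Qed.

(** * Functions regular at the finite places: an integral basis over K[x] *)

Hypothesis charK : p \in [pchar K].

Definition finite_regular (z : F) : Prop := forall P : place iota, vge P x 0 -> vge P z 0.

(** In characteristic p, Tr(y)^p - Tr(y) telescopes to y^(p^u) - y, which therefore lies in
    K[x, 1/h]. The induction on N adds the p^u-th power of one difference to the next. *)
Lemma y_frobenius N : exists s (g : {poly K}), ev x h ^+ s * (y ^+ (p ^ (u * N)) - y) = ev x g.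
Proof.
have charF : p \in [pchar F] by rewrite (fmorph_pchar iota).
have pnat k : [pchar F].-nat (p ^ k)%N by rewrite pnatX pnatE ?charF.
have base : ev x h ^+ p * (y ^+ (p ^ u) - y) = ev x (A ^+ p - A * h ^+ p.-1).
  have trp : tr y ^+ p = tr y + (y ^+ (p ^ u) - y).
    rewrite horner_trace -[X in _ ^+ X]expn1 (sumX_pchar _ _ _ p_prime charF).
    have -> : \sum_(i < u) (y ^+ (p ^ i)) ^+ (p ^ 1) = \sum_(i < u) y ^+ (p ^ i.+1).
      by apply: eq_bigr => i _; rewrite expn1 -exprM -expnSr.
    apply/eqP; rewrite addrA eq_sym subr_eq; apply/eqP.
    have := big_ord_recl u (fun i => y ^+ (p ^ i)) (op := +%R) (idx := 0).
    by rewrite big_ord_recr /= expn0 expr1 => ->; rewrite addrC.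
  have -> : y ^+ (p ^ u) - y = tr y ^+ p - tr y by rewrite trp addrAC subrr add0r.
  rewrite rmorphB rmorphM !rmorphXn /= -F_eq exprMn.
  have -> : ev x h ^+ p = ev x h * ev x h ^+ p.-1 by rewrite -exprS prednK // prime_gt0.
  by ring.
elim: N => [|N [s [g e]]].
  by exists 0%N, 0; rewrite muln0 expn0 expr1 subrr mulr0 rmorph0.
have e2 : ev x h ^+ (s * p ^ u) * (y ^+ (p ^ (u * N.+1)) - y ^+ (p ^ u)) = ev x (g ^+ (p ^ u)).
  rewrite rmorphXn /= -e exprMn -exprM; congr (_ * _).
  have yB (v w : F) : (v - w) ^+ (p ^ u) = v ^+ (p ^ u) - w ^+ (p ^ u).
    by apply/eqP; rewrite eq_sym subr_eq -exprDn_pchar // subrK.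
  by rewrite yB -exprM -expnD mulnS addnC.
exists (s * p ^ u + p)%N, (h ^+ p * g ^+ (p ^ u) + h ^+ (s * p ^ u) * (A ^+ p - A * h ^+ p.-1)).
rewrite rmorphD !rmorphM /= -base -e2 !rmorphXn /= exprD.
set w := y ^+ (p ^ u); ring.
Qed.

Lemma reduced_div z (c q : {poly K}) R : reduced z c R -> q %| c -> (forall j, q %| R`_j) ->
  exists R', reduced z (c %/ q) R'.
Proof.
move=> [c0 sR e] qc qR; have q0 : q != 0 by apply: dvdpN0 qc c0.
exists (\poly_(j < m) (R`_j %/ q)); split.
- by rewrite dvdp_div_eq0.
- exact: size_poly.
apply: (mulfI (peval_x_neq0 q0)).
rewrite mulrA -rmorphM /= [q * _]mulrC divpK // e (peval_widen _ _ sR) (peval_widen _ _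
  (size_poly _ _)) mulr_sumr.
apply: eq_bigr => j _; rewrite coef_poly ltn_ord mulrA -rmorphM /=.
by rewrite [q * _]mulrC divpK.
Qed.

(** The place over d is ramified, so v(R_j y^j) >= v(c) holds for each nonzero R_j separately. As
    v(y) = -1, either j > 0 or v(c) > 0 forces v(R_j) > 0. *)
Lemma reduced_vanish z c R (P : place iota) d : finite_regular z -> reduced z c R ->
  d \in b -> 0 < P (x - iota d) -> forall j : nat, (0 < j)%N || (c.[d] == 0) -> (R`_j).[d] = 0.
Proof.
move=> rz [c0 sR e] db Pd j hj; have [lt|le] := ltnP j m; last first.
  by rewrite nth_default ?horner0 // (leq_trans sR).
have rP := ramified_pole db Pd; have [Py Pxd] := pole_place_spec db Pd.
have vz := rz P (vge_center Pd).
have vc : vge P (ev x c) (if c.[d] == 0 then m%:Z else 0).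
  case: ifP => cd _; last by have [|_ ->] := val_peval_center (c := c) Pd; rewrite ?cd.
  have [k] := val_peval_multiple Pd c0; rewrite Pxd => Pk.
  case: k Pk => [Pk|k ->]; last by rewrite mulrS; lia.
  have [q cq] := factor_theorem _ _ cd; move: Pk.
  have q0 : q != 0 by apply: contraNneq c0 => q0; rewrite cq q0 mul0r.
  rewrite cq rmorphM /= pevalXsubC val_atM ?peval_x_neq0 ?x_center_neq0 // Pxd.
  by have [l ->] := val_peval_multiple Pd q0; rewrite Pxd; have := ramification_gt0; lia.
have vR : vge P (biv x y R) (if c.[d] == 0 then m%:Z else 0).
  by rewrite -e -[X in vge _ _ X]addr0; apply: vgeM.
have vj := @ramified_vge P R _ rP sR vR (Ordinal lt).
apply/eqP; rewrite -[_ == _]negbK; apply/negP => Rd.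
have [Rj0 PRj] := val_peval_center Pd Rd.
move: vj; rewrite /vge mulf_neq0 ?expf_neq0 ?y_neq0 // => /(_ isT).
rewrite val_atM ?expf_neq0 ?y_neq0 // PRj val_exp Py mulNrn natz add0r /=.
have := ramification_gt0; case: (c.[d] == 0) hj; lia.
Qed.

Lemma reduced_h z c R : finite_regular z -> reduced z c R -> forall j : nat, (0 < j)%N -> h %| R`_j.
Proof.
move=> rz cR j j0; rewrite h_def; apply: uniq_roots_dvdp.
  apply/allP => d db; have [P Pd] := center_place_exists d.
  by rewrite /root (reduced_vanish rz cR db Pd) ?j0.
by rewrite uniq_rootsE; move: ab_uniq; rewrite cat_uniq => /and3P[].
Qed.

(* Since y^(p^(u n)) - y is in K[x, 1/h], the coefficients of R(x, y)^(p^(u n)) in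
   the basis y^j are, up to those of higher index, the powers of those of R; and
   integrality of z makes them divisible by c. *)
Lemma reduced_coprime z c R (q : {poly K}) : finite_regular z -> reduced z c R -> q %| c ->
  (1 < size q)%N -> coprimep q h -> (forall d, (q %| d) || coprimep q d) -> forall j, q %| R`_j.
Proof.
move=> rz [c0 sR e] qc q1 qh qirr.
have [n [al zn]] : exists n (al : 'I_n -> {poly K}), z ^+ n = \sum_(i < n) ev x (al i) * z ^+ i.
  apply: integral_of_vge rz; first by move=> w; apply: algebraic_over_Kx.
  by move=> w w0; split; [exact: peval_x_neq0|exists (m * (size w).-1)%N; apply: deg_le_poly].
pose M := (p ^ (u * n))%N.
have le_nM : (n <= M)%N.
  have : (n < p ^ n)%N by apply: ltn_expl; apply: prime_gt1.
  by move/ltnW/leq_trans; apply; rewrite leq_exp2l ?prime_gt1 // leq_pmull.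
(* R(x, y)^M is (c z)^M, and replacing a factor z^n by lower powers z^i leaves c^(n - i) with i < n,
   hence at least one factor c in every term. *)
have [S eS] : exists S, biv x y R ^+ M = ev x c * biv x y S.
  exists (\sum_(i < n) (al i * c ^+ (n - i).-1)%:P * R ^+ (M - n + i)).
  rewrite rmorph_sum mulr_sumr -e exprMn -{2}(subnK le_nM) exprD zn !mulr_sumr.
  apply: eq_bigr => i _; rewrite rmorphM rmorphXn /= -e bivC rmorphM rmorphXn /=.
  have lt_i := ltn_ord i.
  have -> : ev x c ^+ M = ev x c * ev x c ^+ (n - i).-1 * ev x c ^+ (M - n + i).
    by rewrite -exprS -exprD; congr (_ ^+ _); lia.
  by rewrite exprMn !exprD; ring.
have [s [g yM]] := y_frobenius n; rewrite -/M in yM.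
have charF : p \in [pchar F] by rewrite (fmorph_pchar iota).
pose L := (h ^+ s)%:P * 'X + g%:P : {poly {poly K}}.
have bL : biv x y L = ev x h ^+ s * y ^+ M.
  by rewrite /L rmorphD rmorphM /= !bivC pevalX rmorphXn /= -yM; ring.
(* T evaluates to h^(s m) R(x, y)^M: Frobenius acts on the coefficients, and [L], of degree 1 in y,
   stands for h^s y^M. Its degree in y stays below m, so it can be compared with c S coefficient by
   coefficient. *)
pose T := \sum_(j < m) (R`_j ^+ M * h ^+ (s * (m - j)))%:P * L ^+ j : {poly {poly K}}.
have sT : (size T <= m)%N.
  apply: leq_trans (size_sum _ _ _) _; apply/bigmax_leqP => j _.
  rewrite mul_polyC; apply: leq_trans (size_scale_leq _ _) _.
  by have [sL _] := affine_exp (h ^+ s) g j; apply: leq_trans sL _; apply: ltn_ord.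
have bT : biv x y T = ev x h ^+ (s * m) * biv x y R ^+ M.
  rewrite (peval_widen _ _ sR) (sumX_pchar _ _ _ p_prime charF) /T rmorph_sum mulr_sumr.
  apply: eq_bigr => j _; rewrite rmorphM rmorphXn /= bL bivC rmorphM !rmorphXn /=.
  have -> : (s * m = s * (m - j) + s * j)%N by rewrite -mulnDr subnK // ltnW.
  by rewrite !exprMn exprD -!exprM [(M * j)%N]mulnC; ring.
have [k [S' [sS' eS']]] := curve_reduce S.
have TS : h ^+ k *: T = (c * h ^+ (s * m)) *: S'.
  apply/eqP; rewrite -subr_eq0; apply/eqP; apply: biv_eq0.
    apply: leq_trans (size_polyD _ _) _; rewrite size_polyN geq_max.
    by rewrite !(leq_trans (size_scale_leq _ _)).
  rewrite -!mul_polyC rmorphB !rmorphM /= !bivC bT eS -eS' ?rmorphM ?rmorphXn /=.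
  by ring.
have qT j : q %| T`_j.
  have : q %| h ^+ k * T`_j.
    by rewrite -coefZ TS coefZ -mulrA dvdp_mulr.
  by rewrite Gauss_dvdpr // coprimep_expr.
apply: contrapT => /existsNP[j0 nq0].
have ex0 : exists j, ~~ (q %| R`_j) by exists j0; apply/negP.
have bnd j : ~~ (q %| R`_j) -> (j <= m)%N.
  move=> nq; rewrite leqNgt; apply: contra nq => lt.
  by rewrite nth_default ?dvdp0 // (leq_trans sR) // ltnW.
case: (ex_maxnP ex0 bnd) => j nq maxj.
have lt_jm : (j < m)%N.
  rewrite ltnNge; apply: contra nq => le.
  by rewrite nth_default ?dvdp0 // (leq_trans sR).
move: (qT j); rewrite /T coef_sum (bigD1 (Ordinal lt_jm)) //= coefCM.
have [_ ->] := affine_exp (h ^+ s) g j.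
rewrite dvdp_addl.
  rewrite -mulrA mulrC Gauss_dvdpr; last by rewrite coprimepMr !coprimep_expr.
  have /orP[h1|cp] := qirr R`_j; first by rewrite h1 in nq.
  by rewrite -[_ ^+ M]mulr1 Gauss_dvdpr ?coprimep_expr // dvdp1 gtn_eqF.
elim/big_ind: _ => [||i ij]; [exact: dvdp0|exact: dvdp_add|].
rewrite coefCM; have [lt|le] := ltnP j i.
  apply: dvdp_mulr; apply: dvdp_mulr; apply: dvdp_exp; first by rewrite expn_gt0 prime_gt0.
  by rewrite -[_ %| _]negbK; apply/negP => /maxj; rewrite leqNgt lt.
have [sL _] := affine_exp (h ^+ s) g i.
have -> : (L ^+ i)`_j = 0; last by rewrite mulr0 dvdp0.
apply: nth_default; apply: leq_trans sL _.
by rewrite ltn_neqAle le andbT; move: ij; rewrite -val_eqE.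
Qed.

(** For a denominator c of least degree, no nonconstant polynomial divides c and all R_j.
    Ramification then rules out the roots b_i of c, the Frobenius argument its irreducible factors
    prime to h, and c is constant. *)
Lemma finite_regularP z : finite_regular z ->
  exists R : {poly {poly K}}, [/\ (size R <= m)%N, z = biv x y R & forall j : nat, (0 < j)%N ->
    h %| R`_j].
Proof.
move=> rz.
pose S n := exists c R, reduced z c R /\ size c = n.
have ex0 : exists n, `[< S n >].
  by have [c [R cR]] := all_represented z; exists (size c); apply/asboolP; exists c, R.
case: (ex_minnP ex0) => n /asboolP[c [R [cR sc]]] minn.
have [c0 sR e] := cR.
have noq (q : {poly K}) : q %| c -> (forall j, q %| R`_j) -> (size q <= 1)%N.
  move=> qc qR; have [R' cR'] := reduced_div cR qc qR.
  have q0 : q != 0 by apply: dvdpN0 qc c0.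
  have : `[< S (size (c %/ q)) >] by apply/asboolP; exists (c %/ q), R'.
  move/minn; rewrite -sc size_divp // => le; rewrite leqNgt; apply/negP => s1.
  by rewrite leqNgt ltn_subrL -subn1 subn_gt0 s1 size_poly_gt0 c0 in le.
have cb d : d \in b -> c.[d] != 0.
  move=> db; apply/negP => cd; have [P Pd] := center_place_exists d.
  suff : (size ('X - d%:P)%R <= 1)%N by rewrite size_XsubC.
  apply: noq; first by rewrite dvdp_XsubCl /root.
  by move=> j; rewrite dvdp_XsubCl /root (reduced_vanish rz cR db Pd) ?cd ?orbT.
have c1 : (size c <= 1)%N.
  rewrite leqNgt; apply/negP => c1; have [q [q1 qc] qirr] := irreducible_factor c0 c1.
  suff qR : forall j, q %| R`_j by have := noq q qc qR; rewrite leqNgt q1.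
  apply: (reduced_coprime rz cR qc q1 _ qirr).
  rewrite h_def; have : {in b, forall d, c.[d] != 0} by [].
  elim: (b) => [|d t IH] ct; first by rewrite big_nil coprimep1.
  rewrite big_cons coprimepMr IH ?andbT => [|d' d't]; last by apply: ct; rewrite inE d't orbT.
  rewrite coprimep_XsubC; apply: contra (ct d (mem_head _ _)) => qd.
  by rewrite -[_ == 0]/(root c d) -dvdp_XsubCl (dvdp_trans _ qc) // dvdp_XsubCl.
have [k k0 ck] : exists2 k, k != 0 & c = k%:P.
  have ck := size1_polyC c1; exists c`_0 => //.
  by move: c0; rewrite {1}ck polyC_eq0.
exists (k^-1%:P *: R); split.
- exact: leq_trans (size_scale_leq _ _) sR.
- rewrite -mul_polyC rmorphM /= -e ck bivC !pevalC mulrA -rmorphM mulVf // rmorph1 mul1r //.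
by move=> j j0; rewrite coefZ dvdp_mull // (reduced_h rz cR).
Qed.

Lemma algebraic_vge (P : place iota) z : algebraicOver iota z -> vge P z 0.
Proof.
move/integral_algebraic => [q mq rz].
apply: (@vge_integral _ _ iota P z (size q).-1 (fun i => - iota q`_i)).
  by move=> i; apply: vgeN; apply: vgeK.
move: rz; rewrite /root horner_coef size_map_poly.
have -> : size q = (size q).-1.+1 by rewrite prednK // size_poly_gt0 monic_neq0.
rewrite big_ord_recr /= coef_map /= -lead_coefE (monicP mq) rmorph1 mul1r addrC addr_eq0 => /eqP->.
by rewrite -sumrN; apply: eq_bigr => i _; rewrite coef_map mulNr.
Qed.

Lemma adjoin_x (c d : {poly K}) : adjoin iota [set x] (ev x c / ev x d).
Proof.
move=> E [E1 EB Ed] EK Ex; have E0 : 0 \in E by rewrite -(subrr 1) EB.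
pose O : set F := [set z | z \in E].
have rO : ring_set O.
  split=> [|z w Oz Ow|z w Oz Ow]; [exact: E1|exact: (EB z w)|].
  have Owi : w^-1 \in E by rewrite -[w^-1]mul1r; apply: (Ed 1 w).
  by have := Ed z w^-1 Oz Owi; rewrite invrK.
have Oev q : O (ev x q).
  rewrite peval_sum; apply: ring_set_sum => // i _; case: (rO) => _ _ OM; apply: OM;
    first exact: EK.
  by apply: ring_setX => //; apply: Ex.
exact: (Ed _ _ (Oev c) (Oev d)).
Qed.

(** Applied with s the size of a nonzero multiple of h and t = [size b], the degree of h. *)
Let degree_gap (M s t j : nat) : (0 < j)%N -> (t < s)%N ->
  - (M * t)%N%:Z <= - (M * s.-1)%N%:Z - j%:Z -> False.
Proof. nia. Qed.

(** * The place at infinity and the genus *)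

Section InfinitePlace.
Variables (Q : place iota).
Hypothesis Qx : Q x < 0.

Let Qy : Q y = -1. Proof. by have [] := infinite_place_spec Qx. Qed.
Let Qxm : Q x = - m%:Z. Proof. by have [] := infinite_place_spec Qx. Qed.
Let degQ : place_degree Q = 1%N. Proof. by have [] := infinite_place_spec Qx. Qed.

(** Two such places would contribute 2 m to the zeros of 1/x, against the bound m. *)
Lemma infinite_place_unique (P : place iota) : P x < 0 -> P = Q.
Proof.
move=> Px; apply: contrapT => /eqP PQ; have [_ Pxm degP] := infinite_place_spec Px.
have := zeros_bound x_inv_neq0 deg_le_xV (s := [:: P; Q]).
rewrite /= inE PQ => /(_ isT) /(_ _).
rewrite !big_cons big_nil degP degQ !val_inv Pxm Qxm opprK /= => H.
have : (m * 1 + (m * 1 + 0) <= m)%N.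
  by apply: H => R; rewrite !inE => /orP[] /eqP->; rewrite val_inv oppr_gt0.
by have := ramification_gt0; lia.
Qed.

Lemma vge_x (P : place iota) : P <> Q -> vge P x 0.
Proof.
move=> PQ _; rewrite leNgt; apply/negP => /infinite_place_unique; exact: PQ.
Qed.

Lemma val_Q_peval c : c != 0 -> Q (ev x c) = - (m * (size c).-1)%N%:Z.
Proof.
move=> c0; have [_ ->] := val_peval_neg Qx c0; rewrite Qxm mulNrn -mulr_natr natz; lia.
Qed.

Lemma val_Q_xX i : Q (x ^+ i) = - (m * i)%N%:Z.
Proof. by rewrite val_exp Qxm mulNrn -mulr_natr natz PoszM. Qed.

(** A nonzero term R_j y^j with j > 0 has a pole of order at least m * [size b] + j at Q, above the
    bound, so only R_0 remains. The second conjunct turns any bound at Q into one on the degree of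
    c. *)
Lemma regular_bounded z : (forall P, P <> Q -> vge P z 0) -> vge Q z (- (m * size b)%N%:Z) ->
  exists2 c : {poly K}, z = ev x c & forall k : int, vge Q z k -> c != 0 -> k <= - (m * (size
    c).-1)%N%:Z.
Proof.
move=> Pz Qz; have [|R [sR zR hR]] := @finite_regularP z.
  move=> P Px; have [PQ|] := pselect (P = Q); last by move/Pz.
  by move: Px; rewrite PQ /vge x_neq0 => /(_ isT); rewrite leNgt Qx.
have vR k (j : 'I_m) : vge Q z k -> vge Q (ev x R`_j * y ^+ j) k.
  by rewrite zR => vk; apply: (ramified_vge (ramified_infinite Qx)).
have Rj0 (j : 'I_m) : (0 < j)%N -> R`_j = 0.
  move=> j0; apply/eqP; rewrite -[_ == _]negbK; apply/negP => Rj.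
  have := vR _ j Qz; rewrite /vge mulf_neq0 ?expf_neq0 ?y_neq0 ?peval_x_neq0 // => /(_ isT).
  rewrite val_atM ?expf_neq0 ?y_neq0 ?peval_x_neq0 // val_Q_peval // val_exp Qy mulNrn natz.
  have := dvdp_leq Rj (hR j j0); rewrite size_h size_a.
  exact: degree_gap.
have zc : z = ev x R`_0.
  rewrite zR (peval_widen _ _ sR) (bigD1 (Ordinal ramification_gt0)) //= expr0 mulr1 big1 ?addr0 //.
  move=> j; rewrite -val_eqE /= -lt0n => /Rj0->; by rewrite rmorph0 mul0r.
exists R`_0 => // k; rewrite zc => Qk c0.
by rewrite -val_Q_peval //; apply: Qk; apply: peval_x_neq0.
Qed.

Lemma constants z : (forall P : place iota, vge P z 0) -> exists k, z = iota k.
Proof.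
move=> Pz; have [|c zc cN] := @regular_bounded z (fun P _ => Pz P).
  by apply: vgeW (Pz Q); lia.
have [c0|c0] := eqVneq c 0; first by exists 0; rewrite zc c0 !rmorph0.
have := cN 0 (Pz Q) c0; rewrite oppr_ge0 => sc.
exists c`_0; rewrite zc [in LHS](@size1_polyC _ c) ?pevalC //.
have := ramification_gt0; nia.
Qed.

Lemma curve_function_field : function_field iota.
Proof.
split; last first.
  by move=> z alz; apply: constants => P; apply: algebraic_vge.
exists x => //; exists m, (fun i => y ^+ i) => z.
have [c [R [c0 sR e]]] := all_represented z.
exists (fun i => ev x R`_i / ev x c) => [i|]; first exact: adjoin_x.
apply: (mulfI (peval_x_neq0 c0)); rewrite e (peval_widen _ _ sR) mulr_sumr.
apply: eq_bigr => i _; rewrite mulrA; congr (_ * _).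
by rewrite mulrCA divff ?mulr1 // peval_x_neq0.
Qed.

(** A uniformizer T at P satisfies an equation over K[x] with nonzero constant term; the
    coefficients being regular at P, this constant term is divisible by T. *)
Lemma parameter_poly (P : place iota) : P <> Q -> exists2 w : {poly K}, w != 0 & 0 < P (ev x w).
Proof.
move=> PQ; have [T T0 PT] := uniformizer P.
have [q q0 Tq] := algebraic_over_Kx T0; exists q`_0 => //.
suff /(_ (peval_x_neq0 q0)) : vge P (ev x q`_0) 1 by rewrite -gtz0_ge1.
have -> : ev x q`_0 = - (T * biv x T (drop_poly 1 q)).
  apply/eqP; rewrite -addr_eq0; apply/eqP; rewrite -[RHS]Tq [in RHS](poly_split q).
  by rewrite rmorphD rmorphM /= bivC pevalX.
apply: vgeN; rewrite -[1]addr0; apply: vgeM; first by move=> _; rewrite PT.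
rewrite peval_sum; apply: vge_sum => i _; rewrite -[X in vge _ _ X]addr0; apply: vgeM.
  by apply: vge_peval; apply: vge_x.
by apply: vgeX => _; rewrite PT.
Qed.

Lemma curve_parameter (P : place iota) : has_parameter P.
Proof.
have [->|PQ] := pselect (P = Q).
  exists x^-1, m; split; [exact: x_inv_neq0|exact: deg_le_xV|by rewrite val_inv oppr_gt0].
have [w w0 Pw] := parameter_poly PQ; exists (ev x w), (m * (size w).-1)%N.
by split=> //; [exact: peval_x_neq0|exact: deg_le_poly].
Qed.

Lemma pole_x (P : place iota) : pole_divisor x P = m%:Z * place_divisor Q P.
Proof.
rewrite /pole_divisor /place_divisor; have [->|/eqP PQ] := eqVneq P Q.
  by rewrite Qxm opprK mulr1 max_r.
by rewrite mulr0 max_l // oppr_le0; apply: (vge_x PQ x_neq0).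
Qed.

Lemma place_divisor_degree k :
  is_divisor (fun P : place iota => k * place_divisor Q P) /\
  divisor_degree (fun P : place iota => k * place_divisor Q P) = k.
Proof.
have D0 P : P \notin [:: Q] -> k * place_divisor Q P = 0.
  by rewrite inE /place_divisor => /negPf->; rewrite mulr0.
split; first exact: is_divisor_seq D0.
by rewrite (divisor_degree_seq _ D0) // big_seq1 /place_divisor eqxx degQ !mulr1.
Qed.

Local Notation g := ((size b) * (m - 1))%N.

(** The order [m * size b] lies past all the gaps at Q, so l(A) = deg A + 1 - g; concretely 1, x,
    ..., x^(size b) is a basis of L(A). *)
Lemma genus_attained : let A := fun P : place iota => (m * size b)%N%:Z * place_divisor Q P in
  divisor_degree A - (ell A)%:Z + 1 = g%:Z.
Proof.
move=> D; have [_ ->] := place_divisor_degree (m * size b)%N%:Z.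
have m0 := ramification_gt0.
suff -> : ell D = (size b).+1 by move: m0; move: m => M; nia.
have DQ : D Q = (m * size b)%N%:Z by rewrite /D /place_divisor eqxx mulr1.
have DP P : P <> Q -> D P = 0.
  by rewrite /D /place_divisor => /eqP/negPf->; rewrite mulr0.
apply: quotient_dim_eq; [exact: riemann_roch_subspace|exact: subspace0| |].
  exists (fun i : 'I_(size b).+1 => x ^+ i); rewrite riemann_rochE; split=> [i P /=|].
    have [->|PQ] := pselect (P = Q).
      by move=> _; rewrite DQ val_Q_xX lerN2 lez_nat leq_mul2l -ltnS ltn_ord orbT.
    by rewrite DP // oppr0; apply: vgeX; apply: vge_x.
  apply: (@free_distinct _ _ _ Q) => [i|i j ij]; first by rewrite expf_neq0 // x_neq0.
  by rewrite !val_Q_xX eqr_opp eqz_nat eqn_pmul2l.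
exists (fun i : 'I_(size b).+1 => x ^+ i) => z; rewrite riemann_rochE => Dz.
have [||c zc cN] := @regular_bounded z.
- by move=> P PQ; have := Dz P; rewrite DP // oppr0.
- by have := Dz Q; rewrite DQ.
exists (fun i => c`_i); rewrite /= zc (@peval_widen _ _ iota _ _ (size b).+1) ?subrr //.
have [->|c0] := eqVneq c 0; first by rewrite size_poly0.
have := Dz Q; rewrite DQ => /cN/(_ c0); rewrite lerN2 lez_nat leq_pmul2l //.
by case: (size c).
Qed.

(** Where y has a pole, m v(y) = v(A) - v(h) >= - v(h), and j <= m. *)
Lemma vge_hy (P : place iota) j : P <> Q -> (j <= m)%N -> vge P (ev x h * y ^+ j) 0.
Proof.
move=> PQ le_jm; have h0 := @vge_peval _ _ iota P x h (vge_x PQ).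
have [Py|Py] := leP 0 (P y).
  by rewrite -[X in vge _ _ X]addr0; apply: vgeM => //; apply: vgeX => _.
have [_ Pt] := val_trace Py.
have PA := @vge_peval _ _ iota P x A (vge_x PQ) (peval_x_neq0 A_neq0).
move=> _; rewrite val_atM ?expf_neq0 ?y_neq0 ?peval_x_neq0 ?h_neq0 // val_exp.
by move: Pt; rewrite val_trace_y; nia.
Qed.

(* t^-1 = w^-1 + w^(k-1) has polar divisor (w)_0 + m (deg w) (k - 1) Q. *)
Section DivisorBound.
Variables (w : {poly K}) (k : nat).
Hypotheses (w_size : (1 < size w)%N) (k_gt0 : (0 < k)%N).
Local Notation e := (size w).-1.
Let t := ev x w / ev x (1 + w ^+ k).

Let w0 : w != 0. Proof. by rewrite -size_poly_gt0 ltnW. Qed.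

Let size_wk : size (w ^+ k)%R = (e * k).+1.
Proof. by rewrite -size_exp prednK // size_poly_gt0 expf_neq0. Qed.

Let size_c2 : size (1 + w ^+ k)%R = (e * k).+1.
Proof.
rewrite addrC size_polyDl size_wk // size_poly1 ltnS muln_gt0 k_gt0 andbT.
by case: (size w) w_size => // [[|]].
Qed.

Let c2_neq0 : 1 + w ^+ k != 0.
Proof. by rewrite -size_poly_gt0 size_c2. Qed.

Lemma bound_neq0 : t != 0.
Proof. by rewrite mulf_neq0 ?invr_eq0 ?peval_x_neq0. Qed.

Lemma bound_deg_le : deg_le iota t (m * (e * k)).
Proof.
apply: deg_le_x c2_neq0; last by rewrite size_c2.
rewrite -(prednK (ltnW w_size)) ltnS leq_pmulr //.
Qed.

Lemma bound_val_Q : Q t = (m * (e * (k - 1)))%N%:Z.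
Proof.
rewrite val_div ?peval_x_neq0 // !val_Q_peval // size_c2 /= opprK addrC.
by rewrite mulnBr muln1 mulnBr -subzn ?leq_mul2l ?leq_pmulr ?k_gt0 ?orbT.
Qed.

Lemma bound_val (P : place iota) : P <> Q -> Num.max 0 (P t) = P (ev x w).
Proof.
move=> PQ; have Pw := @vge_peval _ _ iota P x w (vge_x PQ) (peval_x_neq0 w0).
have vc := @vge_peval _ _ iota P x (1 + w ^+ k) (vge_x PQ) (peval_x_neq0 c2_neq0).
rewrite val_div ?peval_x_neq0 //; have [Pw0|Pw0] := eqVneq (P (ev x w)) 0.
  by rewrite Pw0 sub0r max_l // oppr_le0.
have [|_ Pc] := @val_add_lt _ _ _ P 1 (ev x w ^+ k) (oner_neq0 _).
  by move=> _; rewrite val_one val_exp; move: Pw Pw0 k_gt0; nia.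
rewrite rmorphD rmorphXn rmorph1 /= Pc val_one subr0 max_r //.
Qed.

Lemma bound_pole_divisor (P : place iota) : pole_divisor t^-1 P =
  if P == Q then (m * (e * (k - 1)))%N%:Z else P (ev x w).
Proof.
rewrite pole_divisorV; case: eqP => [->|PQ]; last exact: bound_val.
by rewrite bound_val_Q max_r.
Qed.

(** Division by w creates at most the poles (w)_0 away from Q and lowers the pole order at Q by m
    deg w. *)
Lemma bound_riemann_roch z : (forall P : place iota, P <> Q -> vge P z 0) ->
  vge Q z (- (m * (e * k))%N%:Z) -> riemann_roch_space (pole_divisor (iota := iota) t^-1) (z /
    ev x w).
Proof.
move=> Pz Qz; rewrite riemann_rochE => P; rewrite bound_pole_divisor.
case: eqP => [->|PQ].
  have -> : - (m * (e * (k - 1)))%N%:Z = - (m * (e * k))%N%:Z + (m * e)%N%:Z.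
    have le1 : (m * e <= m * (e * k))%N by rewrite leq_mul2l leq_pmulr ?orbT.
    by rewrite mulnBr muln1 mulnBr -subzn //; lia.
  by apply: vgeM Qz _ => _; rewrite val_inv val_Q_peval // opprK.
rewrite -[X in vge _ _ X]add0r; apply: vgeM; first exact: Pz.
by move=> _; rewrite val_inv.
Qed.

(** The functions x^i and h y^j x^i with 0 < j < m have distinct pole orders at Q, those kept being
    at most m e k; they are then divided by w. Their number is m e k + 1 - g if e k >= [size b], and
    no smaller otherwise, where the truncated subtraction gives 0. *)
Lemma bound_dim_ge : dim_ge iota (riemann_roch_space (pole_divisor (iota := iota) t^-1)) [set 0]
  ((e * k).+1 + (m - 1) * (e * k - size b)).
Proof.
pose I := ('I_(e * k).+1 + 'I_(m - 1) * 'I_(e * k - size b))%type.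
pose f (i : I) : F := match i with
  | inl i => x ^+ i
  | inr ji => ev x h * y ^+ (ji.1).+1 * x ^+ ji.2
  end.
pose d (i : I) : nat := match i with
  | inl i => (m * i)%N
  | inr ji => (m * (size b + ji.2) + (ji.1).+1)%N
  end.
have f0 i : f i != 0.
  by case: i => [i|ji]; rewrite /= ?mulf_neq0 ?expf_neq0 ?x_neq0 ?y_neq0 ?peval_x_neq0 ?h_neq0.
have Qf i : Q (f i) = - (d i)%:Z.
  case: i => [i|[j i]] /=; first by rewrite val_Q_xX.
  rewrite !val_atM ?mulf_neq0 ?expf_neq0 ?x_neq0 ?y_neq0 ?peval_x_neq0 ?h_neq0 //.
  rewrite val_Q_xX val_Q_peval ?h_neq0 // size_h size_a val_exp Qy mulNrn natz /= mulnDr; lia.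
have lt_m (j : 'I_(m - 1)) : (j.+1 < m)%N by have := ltn_ord j; rewrite ltn_subRL add1n.
have d_le i : (d i <= m * (e * k))%N.
  case: i => [i|[j i]] /=; first by rewrite leq_mul2l -ltnS ltn_ord orbT.
  have lt_i : (size b + i < e * k)%N by rewrite -ltn_subRL; apply: ltn_ord.
  apply: (@leq_trans (m * (size b + i).+1)); last by rewrite leq_mul2l lt_i orbT.
  by rewrite mulnS addnC leq_add2r ltnW.
have d_inj i i' : d i = d i' -> i = i'.
  have m0 := ramification_gt0.
  have dm j n : (j < m)%N -> ((m * n + j) %/ m = n)%N /\ ((m * n + j) %% m = j)%N.
    by move=> lt_j; rewrite mulnC divnMDl // modnMDl divn_small // modn_small // addn0.
  case: i i' => [i|[j i]] [i'|[j' i']] /= e1.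
  - by congr inl; apply: val_inj; move/eqP: e1; rewrite eqn_pmul2l // => /eqP.
  - by have [_] := dm _ (size b + i')%N (lt_m j'); rewrite -e1 modnMr.
  - by have [_] := dm _ (size b + i)%N (lt_m j); rewrite e1 modnMr.
  have [q r] := dm _ (size b + i)%N (lt_m j); have [q' r'] := dm _ (size b + i')%N (lt_m j').
  move: q r; rewrite e1 q' r' => /eqP + [jj']; rewrite eqn_add2l => /eqP ii'.
  by congr (inr (_, _)); apply: val_inj.
have <- : #|{: I}| = ((e * k).+1 + (m - 1) * (e * k - size b))%N.
  by rewrite card_sum card_prod !card_ord.
apply: (dim_geP (e := fun i => f i / ev x w)); split=> [i|].
  apply: bound_riemann_roch => [P PQ|]; last first.
    by move=> _; rewrite Qf lerN2 lez_nat d_le.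
  case: i => [i|[j i]] /=; first by apply: vgeX; apply: vge_x.
  rewrite -[X in vge _ _ X]addr0; apply: vgeM; last by apply: vgeX; apply: vge_x.
  by apply: vge_hy => //; apply/ltnW/lt_m.
apply: (@free_distinct _ _ _ Q) => [i|i i' ii'];
  first by rewrite mulf_neq0 ?f0 ?invr_eq0 ?peval_x_neq0.
rewrite !val_div ?f0 ?peval_x_neq0 // !Qf; apply: contra_neq ii' => ee; apply: d_inj; lia.
Qed.

End DivisorBound.

Lemma divisor_bound (D : place iota -> int) : is_divisor D -> exists (w : {poly K}) k,
  [/\ (1 < size w)%N, (0 < k)%N &
    forall P, D P <= pole_divisor (ev x w / ev x (1 + w ^+ k))^-1 P].
Proof.
move=> /divisor_support[s us D0].
have /choice[q qP] (P : place iota) : exists q : {poly K}, q != 0 /\ (P <> Q -> 0 < P (ev x q)).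
  have [PQ|PQ] := pselect (P = Q); first by exists 1; rewrite oner_neq0.
  by have [q q0 Pq] := parameter_poly PQ; exists q.
pose v := \prod_(P <- s) q P ^+ `|D P|%N.
have v0 : v != 0 by rewrite prodf_seq_neq0; apply/allP => P _; rewrite expf_neq0 //; case: (qP P).
have sw : (1 < size ('X * v)%R)%N.
  by rewrite mulrC size_mulX // ltnS size_poly_gt0.
(* At P in s other than Q, v vanishes to order at least |D(P)|. The factor ['X] makes w nonconstant,
   so that k - 1 = |D(Q)| gives a pole of order at least |D(Q)| at Q. *)
exists ('X * v), `|D Q|%N.+1; split=> // P.
rewrite bound_pole_divisor //; case: eqP => [->|PQ].
  have -> : (`|D Q|.+1 - 1 = `|D Q|)%N by rewrite subn1.
  have : (1 * (1 * `|D Q|) <= m * ((size ('X * v)%R).-1 * `|D Q|))%N.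
    by rewrite !leq_mul ?ramification_gt0 // -ltnS prednK // ltnW.
  move: (m * _)%N => B; lia.
have vx := vge_x PQ.
have Pxv : P (ev x ('X * v)) = P x + P (ev x v).
  by rewrite rmorphM /= pevalX val_atM ?x_neq0 ?peval_x_neq0.
have Px := vx x_neq0; rewrite Pxv.
have Pv := @vge_peval _ _ iota P x v vx (peval_x_neq0 v0).
have [Ps|/D0->] := boolP (P \in s); last by lia.
have vE : v = q P ^+ `|D P| * \prod_(R <- rem P s) q R ^+ `|D R|%N.
  by rewrite /v (perm_big _ (perm_to_rem Ps)) big_cons.
have [qP0 /(_ PQ) PqP] := qP P.
have r0 : \prod_(R <- rem P s) q R ^+ `|D R|%N != 0.
  by apply: contraNneq v0 => r0; rewrite vE r0 mulr0.
have := @vge_peval _ _ iota P x (\prod_(R <- rem P s) q R ^+ `|D R|%N) vx (peval_x_neq0 r0).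
rewrite vE rmorphM rmorphXn /= val_atM ?expf_neq0 ?peval_x_neq0 // val_exp.
move: (P (ev x (\prod_(R <- rem P s) q R ^+ `|D R|%N))) => B; nia.
Qed.

Lemma constants_dim_le : dim_le iota (riemann_roch_space (fun _ : place iota => 0)) [set 0] 1.
Proof.
exists (fun=> 1) => z; rewrite riemann_rochE => Pz.
have [c ->] : exists c, z = iota c by apply: constants => P; have := Pz P; rewrite oppr0.
by exists (fun=> c); rewrite big_ord1 mulr1 /= subrr.
Qed.

Lemma genus_bound (D : place iota -> int) : is_divisor D ->
  divisor_degree D - (ell D)%:Z + 1 <= g%:Z.
Proof.
move=> divD; have [w [k [sw k0 DB]]] := divisor_bound divD.
have t0 := bound_neq0 sw k0; have degt := bound_deg_le sw k0.
set B := pole_divisor _^-1 in DB.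
have divB : is_divisor B by apply: pole_divisorV_is_divisor t0 degt.
have degB : divisor_degree B <= (m * ((size w).-1 * k))%N%:Z by apply: pole_divisorV_degree_le
  t0 degt.
have [d1 dim1 d1E] := riemann_roch_dim_le curve_parameter divD divB DB.
have B0 P : 0 <= B P by rewrite /B /pole_divisor le_max lexx.
(* Comparison of L(B) with L(0), whose elements are constants, shows that L(B) and its subspace L(D)
   are finite-dimensional; thus [ell D] is a true dimension and not the default 0. *)
have div0 : is_divisor (fun _ : place iota => 0 : int) by apply: (@is_divisor_seq _ _ _ [::]).
have [d2 dim2 _] := riemann_roch_dim_le curve_parameter div0 divB B0.
have dimB := dim_le_trans dim2 constants_dim_le.
have [c be] : exists c : 'I_(ell D) -> F, quotient_basis iota (riemann_roch_space D) [set 0] c.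
  apply: (@quotient_dimP _ _ _ _ _ (d2 + 1)); [exact: riemann_roch_subspace|exact: subspace0|].
  move=> n [c [Vc fc]]; apply: dim_ge_le dimB; first exact: subspace0.
  by exists c; split=> // i; apply: riemann_roch_mono DB _ (Vc i).
have dimB' := dim_le_trans dim1 (quotient_basis_dim_le be).
(* With N = e k, this gives m N + 1 - g <= deg B - deg D + l(D), and deg B <= m N. *)
have := dim_ge_le (subspace0 iota) (bound_dim_ge sw k0) dimB'.
have := ramification_gt0; move: d1E degB.
move: (divisor_degree D) (divisor_degree B) (ell D) ((size w).-1 * k)%N (size b) => dD dB l N sb.
move: m => M; nia.
Qed.

Lemma curve_genus : is_genus iota g.
Proof.
split; first exact: genus_bound.
have [divA _] := place_divisor_degree (m * size b)%N%:Z.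
by exists (fun P : place iota => (m * size b)%N%:Z * place_divisor Q P) => //;
  apply: genus_attained.
Qed.

End InfinitePlace.

(** * The functions z1 and z2 *)

Lemma zero_places : exists s : seq (place iota),
  [/\ uniq s, size s = size a & forall P, P \in s -> 0 < P y].
Proof.
have /choice[f fP] c : exists P : place iota, c \in a -> 0 < P (x - iota c) /\ 0 < P y.
  have [/zero_place_exists[P PP]|ca] := boolP (c \in a); first by exists P.
  by have [P _] := center_place_exists c; exists P.
exists (map f a); split; last 1 first.
- by move=> P /mapP[c ca ->]; have [] := fP c ca.
- rewrite map_inj_in_uniq; first by move: ab_uniq; rewrite cat_uniq => /and3P[].
  move=> c d ca da fcd; apply/eqP; rewrite -[_ == _]negbK; apply/negP => cd.
  have [Pc _] := fP c ca; have [Pd _] := fP d da.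
  by have [_] := val_sub_const cd Pc; rewrite fcd => Pd0; rewrite Pd0 in Pd.
by rewrite size_map.
Qed.

Lemma curve_friendly n : friendly iota m n.
Proof.
have [Q Qx] := infinite_place_exists; split; first exact: curve_function_field Qx.
exists (size b * (m - 1))%N; first exact: curve_genus Qx.
exists Q; split; first exact: dvdn_mull; last by exists x; apply: pole_x.
have [Qy Qxm _] := infinite_place_spec Qx.
(* For m = 1 the genus is 0 and the required degree is 1, with 0 / 0 read as 0, whereas the polar
   divisor of 1/y has degree [size a]; hence the reciprocal of a linear polynomial in x. *)
have [m1|m1] := leqP m 1.
  have mE : m = 1%N by apply/eqP; rewrite eqn_leq m1 ramification_gt0.
  have [c ca] : exists c, c \in a.
    by case: a size_a => // c t _; exists c; apply: mem_head.
  have [P Pc] := center_place_exists c.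
  exists (x - iota c)^-1.
    have [_] := val_peval_neg (c := 'X - c%:P) Qx (negbT (polyXsubC_eq0 c)).
    by rewrite pevalXsubC size_XsubC mulr1n val_inv => ->; rewrite Qxm mE.
  rewrite mE subnn muln0 divn0 add0n.
  apply: (@pole_divisorV_degree_eq _ _ _ _ 1 (x_center_neq0 c) _ [:: P]) => //.
    by have := @deg_le_center c; rewrite mE.
  by move=> P'; rewrite inE => /eqP->.
exists y^-1; first by rewrite val_inv Qy.
(* The [size a] zeros of y already fill the bound [deg_le_y], and [size a] = [size b] + 1 = g / (m -
   1) + 1. *)
have [s [us ss sP]] := zero_places.
rewrite (pole_divisorV_degree_eq y_neq0 deg_le_y us ss sP).
by rewrite mulnK ?subn_gt0 // addn1 size_a.
Qed.

End Curve.

Theorem theorem3p3 (p r n u m l : nat) (Fq : finFieldType)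
    (p_prime : prime p) (r_gt0 : (0 < r)%N) (card_Fq : #|Fq| = (p ^ r)%N)
    (n_gt0 : (0 < n)%N)
    (u_gt0 : (0 < u)%N) (m_def : m = (p ^ (u - 1))%N)
    (l_ge2 : (2 <= l)%N)
    (a : l.-tuple Fq) (b : (l - 1).-tuple Fq) (ab_uniq : uniq (a ++ b))
    (F : fieldType) (iota : {rmorphism Fq -> F}) (x y : F)
    (x_transc : ~ algebraicOver iota x)
    (F_gen : adjoin iota [set x; y] = [set: F])
    (F_eq : (trace_poly F p u).[y] =
      (\prod_(c <- a) (x - iota c)) / (\prod_(c <- b) (x - iota c))) :
  friendly iota m n.
Proof.
have charK : p \in [pchar Fq] by apply: card_finPcharP card_Fq p_prime.
have ev_prod (s : seq Fq) :
    peval iota x (\prod_(c <- s) ('X - c%:P)) = \prod_(c <- s) (x - iota c).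
  by rewrite rmorph_prod; apply: eq_bigr => c _; rewrite /= pevalXsubC.
have size_ab : size a = (size b).+1 by rewrite !size_tuple subn1 prednK // ltnW.
rewrite m_def; apply: (@curve_friendly _ _ iota p u a b x y _ _ erefl erefl) => //.
(* The denominator can be cleared because x is transcendental, so h(x) is nonzero. *)
rewrite !ev_prod F_eq mulrC divfK // -ev_prod peval_eq0 //.
exact/monic_neq0/monic_prod_XsubC.
Qed.
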